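(* Let $K\subset\mathbb{R}^2$ be a smooth, strictly convex disc. Then $K$ has a monohedral tiling with two tiles if and only if $K$ is centrally symmetric or axially symmetric. Moreover, for every monohedral tiling $\{\mathcal D_1,\mathcal D_2\}$ of $K$ with two tiles, and every isometry $g$ of the plane with $g(\mathcal D_1)=\mathcal D_2$, the isometry $g$ is the corresponding symmetry of $K$: either the point reflection about a center of symmetry of $K$, or the reflection about a line that is an axis of symmetry of $K$.
   Context: A topological disc is a subset of the plane homeomorphic to the closed circular unit disc. A finite set of topological discs is a tiling of $K$ if the union of the discs is $K$ and their interiors are pairwise disjoint; the members are called tiles. A tiling is monohedral if all tiles are congruent, i.e. any two tiles are images of each other under an isometry of the Euclidean plane (orientation-preserving or orientation-reversing). A convex disc is a convex topological disc in the plane (compact, convex, with non-empty interior). It is strictly convex if its boundary contains no non-degenerate line segment. It is smooth if its boundary is a differentiable curve, i.e. has a unique tangent line at every point (for a convex disc this is equivalent to the boundary being continuously differentiable). $K$ is centrally symmetric if it is invariant under reflection about some point, and axially symmetric if it is invariant under reflection about some line. *)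

(* Defs.v *)
From HB Require Import structures.
From mathcomp Require Import all_boot all_order all_algebra.
From mathcomp Require Import all_classical all_reals all_analysis.

Set Implicit Arguments.
Unset Strict Implicit.
Unset Printing Implicit Defensive.

Import Order.TTheory GRing.Theory Num.Theory.
Import numFieldNormedType.Exports.

Local Open Scope classical_set_scope.
Local Open Scope ring_scope.

(* The library norm on 'rV[R]_2 is the sup norm. It induces the usual topology
   of the plane, so it is used for topological notions only; everything metric
   below goes through the Euclidean distance [dist]. *)
Notation plane R := 'rV[R]_2.

Section Euclidean.
Variable R : realType.
Implicit Types (a b c p q u v x y : plane R) (L A : set (plane R)).

Definition dot u v : R := \sum_(i < 2) u ord0 i * v ord0 i.
Definition dist x y : R := Num.sqrt (dot (x - y) (x - y)).

Definition euclidean_isometry (g : plane R -> plane R) :=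
  forall x y, dist (g x) (g y) = dist x y.

Definition congruent A B := exists2 g, euclidean_isometry g & g @` A = B.

Definition line a u : set (plane R) := [set a + t *: u | t in [set: R]].
Definition is_line L := exists a u, u != 0 /\ L = line a u.

Definition segment a b : set (plane R) :=
  [set (1 - t) *: a + t *: b | t in [set t : R | 0 <= t <= 1]].

Definition point_reflection c x : plane R := c *+ 2 - x.

(* Twice the foot of the perpendicular from [x] to [line a u], minus [x];
   meaningful for [u != 0]. *)
Definition line_reflection a u x : plane R :=
  (a + (dot (x - a) u / dot u u) *: u) *+ 2 - x.

End Euclidean.

Section Discs.
Variable R : realType.
Implicit Types (A B D K L : set (plane R)) (T : set (set (plane R))).

Definition homeomorphic A B := exists f g : plane R -> plane R,
  [/\ {within A, continuous f}, {within B, continuous g},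
      f @` A `<=` B /\ g @` B `<=` A,
      (forall x, A x -> g (f x) = x) &
      (forall y, B y -> f (g y) = y)].

Definition unit_disc : set (plane R) := [set x | dist x 0 <= 1].

Definition topological_disc D := homeomorphic unit_disc D.

Definition boundary A : set (plane R) := closure A `\` interior A.

Definition convex_disc K :=
  [/\ compact K, convex_set (K : set (convex_lmodType (plane R))) &
      interior K !=set0].

Definition strictly_convex K :=
  forall a b, a != b -> ~ (segment a b `<=` boundary K).

(* [L] is a line through [p] to which the curve [C] is tangent at [p]: the
   distance from a point [q] of [C] to [L] is o(dist q p) as [q] tends to [p]. *)
Definition tangent_line (C : set (plane R)) (p : plane R) L :=
  [/\ is_line L, L p &
      forall e : R, 0 < e -> \forall q \near p,
        C q -> exists2 m, L m & dist q m <= e * dist q p].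

Definition smooth K :=
  forall p, boundary K p -> exists! L, tangent_line (boundary K) p L.

Definition symmetry_center K c := point_reflection c @` K = K.
Definition centrally_symmetric K := exists c, symmetry_center K c.

(* [line a u] is an axis of symmetry of [K] *)
Definition symmetry_axis K a u := u != 0 /\ line_reflection a u @` K = K.
Definition axially_symmetric K := exists a u, symmetry_axis K a u.

Definition tiling K T :=
  [/\ finite_set T, (forall D, T D -> topological_disc D),
      \bigcup_(D in T) D = K & trivIset T (@interior (plane R))].

Definition monohedral_tiling K T :=
  tiling K T /\ forall D E, T D -> T E -> congruent D E.

End Discs.

(* Main.v *)
(* Let g be an isometry with g D1 = D2; it suffices that g is an involution, for
   then g maps K = D1 u D2 to itself. By invariance of domain a tile is the
   closure of its interior, so along an orbit of g inside int K the two tiles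
   alternate. A point of K outside g K lies in D1 and a point leaving K under g
   lies in D2: every finite run of the orbit inside int K between two points
   outside K has even length.
   - If g is a translation or a glide reflection, look at orbits near the chord
     that an invariant line cuts from K. Moving the starting point produces two
     runs whose lengths differ by one; strict convexity is used when the chord
     is an integral multiple of the translation length.
   - If g is a rotation, not a half-turn, its centre o lies in K: otherwise the
     point of K nearest to o is a run of length one.
   - If o is on the boundary, then near o the disc K is almost a half-plane by
     smoothness, and two runs of lengths differing by one exist again.
   - If o is interior, it corresponds to a boundary point of the unit disc under
     a parametrization of D1, so D1 minus o carries a continuous branch of the
     angle around o. Near o the map g^2 preserves D1 and changes this branch by a
     nonzero constant, so the branch is unbounded on an orbit. But an orbit stays
     in a compact part of D1 minus o. *)

Require Import Defs.
From mathcomp Require Import all_boot all_order all_algebra.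
From mathcomp Require Import all_classical all_reals all_analysis.
From mathcomp Require Import ring lra.

Set Implicit Arguments.
Unset Strict Implicit.
Unset Printing Implicit Defensive.

Import Order.TTheory GRing.Theory Num.Theory.
Import numFieldNormedType.Exports.

Local Open Scope classical_set_scope.
Local Open Scope ring_scope.

(** * Angles and their continuous lifts *)

Section Angles.
Variable R : realType.
Implicit Types (a b t : R).

(** The polar angle as a relation: it is determined modulo [2 * pi] only, and the origin has
    none. *)
Definition has_angle (x y : R) a := exists2 r, 0 < r & x = r * cos a /\ y = r * sin a.

Lemma sin_atan_div (x y : R) : 0 < x ->
  exists2 w, 0 < w & cos (atan (y / x)) = x / w /\ sin (atan (y / x)) = y / w.
Proof.
move=> x0; have c0 : 0 < cos (atan (y / x)).
  by rewrite cos_gt0_pihalf// atan_gtNpi2 atan_ltpi2.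
exists (x / cos (atan (y / x))); first by rewrite divr_gt0.
have e : sin (atan (y / x)) = y / x * cos (atan (y / x)).
  by have := atanK (y / x); move: c0; set t := atan _ => c0;
    rewrite /tan => <-; rewrite divfK ?gt_eqF.
split; last by rewrite e; field; rewrite !gt_eqF.
by field; rewrite !gt_eqF.
Qed.

(** The argument of [atan] is a cross product over a dot product, hence the tangent of the angle
    from [(x0, y0)] to [(x, y)]; a positive dot product keeps that angle within a right angle, where
    [atan] recovers it. *)
Lemma has_angle_step (x0 y0 x y : R) a : has_angle x0 y0 a -> 0 < x * x0 + y * y0 ->
  has_angle x y (a + atan ((y * x0 - x * y0) / (x * x0 + y * y0))).
Proof.
move=> [r r0 [ex0 ey0]] P0.
have [w w0 [cw sw]] := sin_atan_div (y * x0 - x * y0) P0.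
exists (w / r); first by rewrite divr_gt0.
rewrite cosD sinD cw sw ex0 ey0; have e := cos2Dsin2 a.
split; apply: (@mulfI _ r); rewrite ?gt_eqF//.
  transitivity (r * x * (cos a ^+ 2 + sin a ^+ 2)); first by rewrite e mulr1.
  by field; rewrite !gt_eqF.
transitivity (r * y * (cos a ^+ 2 + sin a ^+ 2)); first by rewrite e mulr1.
by field; rewrite !gt_eqF.
Qed.

(** A nonzero vector has a positive dot product with one of the four axis directions, whose angles
    are known. *)
Lemma has_angle_ex (x y : R) : (x != 0) || (y != 0) -> exists a, has_angle x y a.
Proof.
have h a : has_angle (cos a) (sin a) a by exists 1 => //; rewrite !mul1r.
have k a : 0 < x * cos a + y * sin a -> exists a, has_angle x y a.
  by move=> p; eexists; exact: has_angle_step (h a) p.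
case: (ltrgtP x 0) => [x0 _|x0 _|x0]/=.
- by apply: (k pi); rewrite cospi sinpi mulr0 addr0 mulrN1 oppr_gt0.
- by apply: (k 0); rewrite cos0 sin0 mulr0 addr0 mulr1.
case: (ltrgtP y 0) => // y0 _.
- apply: (k (- (pi / 2))); rewrite cosN sinN cos_pihalf sin_pihalf.
  by rewrite mulr0 add0r mulrN1 oppr_gt0.
- by apply: (k (pi / 2)); rewrite cos_pihalf sin_pihalf mulr0 add0r mulr1.
Qed.

Lemma has_angle_uniq (x y : R) a b : has_angle x y a -> has_angle x y b ->
  cos a = cos b /\ sin a = sin b.
Proof.
move=> [r r0 [ex ey]] [s s0 [ex' ey']].
have rs : r = s.
  have : r ^+ 2 = s ^+ 2.
    transitivity (x ^+ 2 + y ^+ 2).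
      by rewrite ex ey !exprMn -mulrDr cos2Dsin2 mulr1.
    by rewrite ex' ey' !exprMn -mulrDr cos2Dsin2 mulr1.
  by move/eqP; rewrite eqrXn2 ?ltW// => /eqP.
subst s; have rn : r != 0 by rewrite gt_eqF.
by split; apply: (mulfI rn); rewrite -?ex -?ey.
Qed.

Lemma has_angle_rot (x y : R) a t : has_angle x y a ->
  has_angle (cos t * x - sin t * y) (sin t * x + cos t * y) (a + t).
Proof.
move=> [r r0 [-> ->]]; exists r => //; rewrite cosD sinD.
by split; ring.
Qed.

Lemma cos_sin_B a b t : cos (a + t) = cos b -> sin (a + t) = sin b ->
  cos (b - a) = cos t /\ sin (b - a) = sin t.
Proof.
move=> e1 e2; have e := cos2Dsin2 a.
rewrite cosB sinB -e1 -e2 cosD sinD; split.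
  transitivity (cos t * (cos a ^+ 2 + sin a ^+ 2)); last by rewrite e mulr1.
  by ring.
transitivity (sin t * (cos a ^+ 2 + sin a ^+ 2)); last by rewrite e mulr1.
by ring.
Qed.

(** The values of [f] agree modulo [2 * pi]. If two of them differed, the intermediate value theorem
    would give a value too close to [f a]. *)
Lemma continuous_angle_const (f : R -> R) a b (c s : R) : a <= b ->
  (forall x, a <= x <= b -> {for x, continuous f}) ->
  (forall x, a <= x <= b -> cos (f x) = c /\ sin (f x) = s) -> f a = f b.
Proof.
wlog le_ab : f s / f a <= f b => [H|].
  case: (leP (f a) (f b)) => [|/ltW]; first exact: H.
  move=> fab ab fc fcs; apply/oppr_inj; apply: (H (fun x => - f x) (- s)) => //.
  - by rewrite lerN2.
  - by move=> x xab; apply: continuousN; exact: fc.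
  - by move=> x /fcs [<- <-]; rewrite cosN sinN.
move=> ab fc fcs; apply/eqP; rewrite eq_le le_ab leNgt /=; apply/negP => fab.
(* The cap at [pi] keeps [d] in the interval where [cos] is injective. *)
pose d := Num.min pi (f b - f a).
have d0 : 0 < d by rewrite lt_min pi_gt0 subr_gt0.
have dpi : d <= pi by rewrite ge_min lexx.
have db : d <= f b - f a by rewrite ge_min lexx orbT.
have wfc : {within `[a, b], continuous f}.
  by apply: continuous_in_subspaceT => x; rewrite inE/= in_itv/=; exact: fc.
have [|x + fx] := @IVT R f a b (f a + d) ab wfc.
  by rewrite (min_idPl le_ab) (max_idPr le_ab); lra.
rewrite in_itv/= => xab.
have [ca sa] := fcs a ltac:(by rewrite lexx).
have [cx sx] := fcs x xab.
rewrite fx in cx sx.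
have [cd _] : cos d = 1 /\ sin d = 0.
  have [] := @cos_sin_B (f a) (f a) d; rewrite ?ca ?cx ?sa ?sx// subrr.
  by rewrite cos0 sin0 => <- <-.
suff : d = 0 by move/eqP; rewrite gt_eqF.
by apply: cos_inj; rewrite ?in_itv/= ?lexx ?pi_ge0 ?cos0// ltW.
Qed.

(** * Lifting the angle along rays of a compact star-shaped set *)

Section Lift.
Variables (V : normedModType R) (X Y : V -> R) (A : set V).
Hypotheses (cX : continuous X) (cY : continuous Y).

Let dotXY u v := X u * X v + Y u * Y v.

(* Adds up the principal angles between consecutive values of [(X, Y)] at the
   points [h * i *: x], starting from the angle [a0] at the origin. *)
Fixpoint lift_steps (h a0 : R) n (x : V) : R :=
  if n is m.+1 then
    lift_steps h a0 m x +
    atan ((Y ((h * n%:R) *: x) * X ((h * m%:R) *: x)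
           - X ((h * n%:R) *: x) * Y ((h * m%:R) *: x)) /
          dotXY ((h * n%:R) *: x) ((h * m%:R) *: x))
  else a0.

Lemma lift_stepsP h a0 n (x : V) : has_angle (X 0) (Y 0) a0 ->
  (forall m, (m < n)%N -> 0 < dotXY ((h * m.+1%:R) *: x) ((h * m%:R) *: x)) ->
  {for x, continuous (lift_steps h a0 n)} /\
  has_angle (X ((h * n%:R) *: x)) (Y ((h * n%:R) *: x)) (lift_steps h a0 n x).
Proof.
move=> a0P; elim: n => [|n IH] p0 /=.
  by split; [exact: cst_continuous | rewrite mulr0 scale0r].
have [m mn|cn an] := IH; first by apply: p0; rewrite ltnW.
have pn := p0 n (ltnSn n).
split; last exact: has_angle_step.
have cs (f : V -> R) k : continuous f -> {for x, continuous (fun y => f (k *: y))}.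
  move=> cf; apply: (@continuous_comp _ _ _ (fun y => k *: y) f); last exact: cf.
  exact: scaler_continuous.
apply: continuousD; first exact: cn.
apply: (@continuous_comp _ _ _ _ atan); last exact: continuous_atan.
apply: continuousM.
  by apply: continuousB; apply: continuousM; exact: cs.
apply: continuousV; first by rewrite gt_eqF.
by apply: continuousD; apply: continuousM; exact: cs.
Qed.

(** On the diagonal [dotXY] is a positive squared length; continuity and compactness turn this into
    one margin [e] for all of [A]. *)
Lemma dotXY_uniform : compact A ->
  (forall x : V, A x -> (X x != 0) || (Y x != 0)) ->
  \forall e \near 0^'+, forall x : V, A x ->
    forall y : V, `|x - y| < e -> 0 < dotXY y x.
Proof.
move=> cA nzA.
have := (@compact_near_coveringP V A).1 cA R 0^'+
  (fun e (x : V) => forall y : V, `|x - y| < e -> 0 < dotXY y x) _.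
apply => x Ax.
have p : 0 < dotXY x x.
  rewrite /dotXY -!expr2; case/orP: (nzA _ Ax) => h.
    by rewrite ltr_wpDr ?sqr_ge0// lt_def sqr_ge0 sqrf_eq0 h.
  by rewrite ltr_wpDl ?sqr_ge0// lt_def sqr_ge0 sqrf_eq0 h.
have cD : {for (x, x), continuous (fun uv : V * V => dotXY uv.1 uv.2)}.
  have c1 (f : V -> R) : continuous f ->
      {for (x, x), continuous (fun uv : V * V => f uv.1)}.
    by move=> cf; apply: (@continuous_comp _ _ _ fst f); [exact: cvg_fst|exact: cf].
  have c2 (f : V -> R) : continuous f ->
      {for (x, x), continuous (fun uv : V * V => f uv.2)}.
    by move=> cf; apply: (@continuous_comp _ _ _ snd f); [exact: cvg_snd|exact: cf].
  by apply: continuousD; apply: continuousM;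
    [exact: c1|exact: c2|exact: c1|exact: c2].
have : \forall uv \near (x, x), 0 < dotXY uv.1 uv.2.
  exact: (cD _ (lt_nbhsr p)).
move=> [[U W] /= [/nbhs_ballP[e1 /= e10 U1] /nbhs_ballP[e2 /= e20 W2]] UW].
have e12 : 0 < e1 / 2 by rewrite divr_gt0.
near=> u e => y /= uy.
apply: (UW (y, u)); split => /=.
  apply: U1; rewrite -ball_normE /=.
  rewrite (le_lt_trans (ler_distD u _ _))//.
  rewrite [ltRHS](splitr e1); apply: ltrD.
    by near: u; have := nbhsx_ballx x (e1 / 2) e12; rewrite -ball_normE.
  by apply: (lt_le_trans uy); near: e; exact: nbhs_right_le.
by apply: W2; near: u; exact: nbhsx_ballx.
Unshelve. all: by end_near. Qed.

(** The segment from the origin to [x] stays in [A] and is cut into [N] equal steps, each shorter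
    than the uniform margin, so that all principal angles summed by [lift_steps] are legitimate. The
    same [N] serves all [x], which makes the lift continuous. *)
Lemma angle_lift : compact A ->
  (forall x t, A x -> 0 <= t <= 1 -> A (t *: x)) ->
  (forall x : V, A x -> (X x != 0) || (Y x != 0)) ->
  exists a : V -> R, forall x, A x ->
    {for x, continuous a} /\ has_angle (X x) (Y x) (a x).
Proof.
move=> cA starA nzA.
have [A0|/set0P[x0 Ax0]] := eqVneq A set0.
  by exists (fun=> 0) => x; rewrite A0.
have Az : A 0 by rewrite -(scale0r x0); apply: starA; rewrite ?lexx ?ler01.
have [a0 a0P] := has_angle_ex (nzA _ Az).
have [e /= e0 eP] := dotXY_uniform cA nzA.
have eP2 := eP (e / 2); rewrite /ball_/= sub0r normrN in eP2.
have {eP2} eP2 : forall x : V, A x -> forall y : V, `|x - y| < e / 2 -> 0 < dotXY y x.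
  by apply: eP2; rewrite ?divr_gt0// gtr0_norm ?divr_gt0//; lra.
have [M [Mreal MA]] := compact_bounded cA.
have M1 : M < `|M| + 1 by rewrite (le_lt_trans (ler_norm _))// ltrDl.
have {}MA := MA _ M1; set B := `|M| + 1 in M1 MA.
have B0 : 0 < B by rewrite ltr_wpDl.
have e2B : 0 <= B / (e / 2) by rewrite divr_ge0 ?ltW// divr_gt0.
pose N := (Num.truncn (B / (e / 2))).+1.
have NB : B / (e / 2) < N%:R by rewrite truncnS_gt.
have N0 : 0 < N%:R :> R by rewrite ltr0n.
exists (lift_steps N%:R^-1 a0 N) => x Ax.
have [|cx] := @lift_stepsP N%:R^-1 a0 N x a0P; last first.
  by rewrite mulVf ?gt_eqF// scale1r.
move=> m mN.
apply: eP2.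
  apply: starA => //; rewrite mulr_ge0 ?invr_ge0 ?ler0n//= mulrC.
  by rewrite ler_pdivrMr// mul1r ler_nat ltnW.
rewrite -scalerBl -mulrBr -[m.+1]addn1 natrD opprD addrA subrr sub0r mulrN1.
rewrite normrZ normrN gtr0_norm ?invr_gt0//.
rewrite mulrC ltr_pdivrMr// (le_lt_trans (MA _ Ax))//.
by rewrite mulrC -ltr_pdivrMr ?divr_gt0.
Qed.

End Lift.
End Angles.

(** * The Euclidean plane *)

Section PlaneGeometry.
Variable R : realType.
Implicit Types (u v w p q : plane R) (A B K : set (plane R)).

Definition cx u : R := u ord0 ord0.
Definition cy u : R := u ord0 ord_max.
Definition vec (a b : R) : plane R := \row_(i < 2) (if i == ord0 then a else b).

Lemma cx_vec a b : cx (vec a b) = a. Proof. by rewrite /cx mxE. Qed.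
Lemma cy_vec a b : cy (vec a b) = b. Proof. by rewrite /cy mxE. Qed.

Lemma planeP u v : cx u = cx v -> cy u = cy v -> u = v.
Proof.
move=> ex ey; apply/rowP => i; case: (unliftP ord_max i) => [j|] -> //.
by rewrite ord1; have -> : lift ord_max ord0 = ord0 :> 'I_2 by exact: val_inj.
Qed.

Lemma cx0 : cx 0 = 0. Proof. by rewrite /cx mxE. Qed.
Lemma cy0 : cy 0 = 0. Proof. by rewrite /cy mxE. Qed.
Lemma cxD u v : cx (u + v) = cx u + cx v. Proof. by rewrite /cx mxE. Qed.
Lemma cyD u v : cy (u + v) = cy u + cy v. Proof. by rewrite /cy mxE. Qed.
Lemma cxN u : cx (- u) = - cx u. Proof. by rewrite /cx mxE. Qed.
Lemma cyN u : cy (- u) = - cy u. Proof. by rewrite /cy mxE. Qed.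
Lemma cxZ a u : cx (a *: u) = a * cx u. Proof. by rewrite /cx mxE. Qed.
Lemma cyZ a u : cy (a *: u) = a * cy u. Proof. by rewrite /cy mxE. Qed.
Lemma cxMn u n : cx (u *+ n) = cx u *+ n.
Proof. by rewrite -scaler_nat cxZ mulr_natl. Qed.
Lemma cyMn u n : cy (u *+ n) = cy u *+ n.
Proof. by rewrite -scaler_nat cyZ mulr_natl. Qed.

Lemma dotE u v : dot u v = cx u * cx v + cy u * cy v.
Proof.
rewrite /dot 2!big_ord_recl big_ord0 addr0.
by have -> : lift ord0 ord0 = ord_max :> 'I_2 by exact: val_inj.
Qed.

Definition coordE := (cx_vec, cy_vec, cx0, cy0, cxD, cyD, cxN, cyN, cxZ, cyZ,
  cxMn, cyMn).

Lemma dotC u v : dot u v = dot v u.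
Proof. by rewrite !dotE; ring. Qed.
Lemma dotDl u v w : dot (u + v) w = dot u w + dot v w.
Proof. by rewrite !dotE !coordE; ring. Qed.
Lemma dotDr u v w : dot w (u + v) = dot w u + dot w v.
Proof. by rewrite !dotE !coordE; ring. Qed.
Lemma dotNl u v : dot (- u) v = - dot u v.
Proof. by rewrite !dotE !coordE; ring. Qed.
Lemma dotNr u v : dot u (- v) = - dot u v.
Proof. by rewrite !dotE !coordE; ring. Qed.
Lemma dotZl a u v : dot (a *: u) v = a * dot u v.
Proof. by rewrite !dotE !coordE; ring. Qed.
Lemma dotZr a u v : dot u (a *: v) = a * dot u v.
Proof. by rewrite !dotE !coordE; ring. Qed.
Lemma dot0l u : dot 0 u = 0.
Proof. by rewrite !dotE !coordE; ring. Qed.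
Lemma dot_ge0 u : 0 <= dot u u.
Proof. by rewrite dotE -!expr2 addr_ge0 ?sqr_ge0. Qed.
Lemma dot_eq0 u : (dot u u == 0) = (u == 0).
Proof.
apply/eqP/eqP => [|->]; last exact: dot0l.
rewrite dotE -!expr2 => /eqP; rewrite paddr_eq0 ?sqr_ge0// !sqrf_eq0.
by move=> /andP[/eqP x0 /eqP y0]; apply: planeP; rewrite ?x0 ?y0 coordE.
Qed.
Lemma dot_gt0 u : (0 < dot u u) = (u != 0).
Proof. by rewrite lt_def dot_ge0 andbT dot_eq0. Qed.

Definition dotE_lin := (dotDl, dotDr, dotNl, dotNr, dotZl, dotZr).

Definition enorm u : R := Num.sqrt (dot u u).

Lemma distE u v : dist u v = enorm (u - v). Proof. by []. Qed.
Lemma enorm_ge0 u : 0 <= enorm u. Proof. exact: sqrtr_ge0. Qed.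
Lemma enorm_sqr u : enorm u ^+ 2 = dot u u.
Proof. by rewrite sqr_sqrtr// dot_ge0. Qed.
Lemma enorm_eq0 u : (enorm u == 0) = (u == 0).
Proof. by rewrite -dot_eq0 -enorm_sqr sqrf_eq0. Qed.
Lemma enorm_gt0 u : (0 < enorm u) = (u != 0).
Proof. by rewrite lt_def enorm_ge0 andbT enorm_eq0. Qed.
Lemma enorm0 : enorm 0 = 0. Proof. by apply/eqP; rewrite enorm_eq0. Qed.
Lemma enormZ a u : enorm (a *: u) = `|a| * enorm u.
Proof.
by rewrite /enorm dotZl dotZr mulrA -expr2 sqrtrM ?sqr_ge0// sqrtr_sqr.
Qed.
Lemma enormN u : enorm (- u) = enorm u.
Proof. by rewrite /enorm dotNl dotNr opprK. Qed.

Lemma cauchy_schwarz u v : dot u v <= enorm u * enorm v.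
Proof.
rewrite real_leNgt ?num_real//; apply/negP => h.
have : (enorm u * enorm v) ^+ 2 < dot u v ^+ 2.
  by rewrite ltrXn2r// ?mulr_ge0 ?enorm_ge0// ltW// (le_lt_trans _ h)//
    mulr_ge0 ?enorm_ge0.
rewrite exprMn !enorm_sqr ltNge => /negP; apply.
(* Lagrange's identity. *)
rewrite -subr_ge0 (_ : _ - _ = (cx u * cy v - cy u * cx v) ^+ 2) ?sqr_ge0//.
by rewrite !dotE; ring.
Qed.

Lemma cauchy_schwarz_norm u v : `|dot u v| <= enorm u * enorm v.
Proof.
rewrite ler_norml cauchy_schwarz andbT lerNl -dotNl.
by rewrite (le_trans (cauchy_schwarz _ _))// enormN.
Qed.

Lemma ler_enormD u v : enorm (u + v) <= enorm u + enorm v.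
Proof.
rewrite -(@ler_pXn2r _ 2) ?nnegrE ?addr_ge0 ?enorm_ge0//.
rewrite enorm_sqr sqrrD !enorm_sqr !dotE_lin (dotC v u).
by have := cauchy_schwarz u v; lra.
Qed.

Lemma normE_le u : `|u| <= enorm u.
Proof.
have h (a b : R) : `|a| <= Num.sqrt (a * a + b * b).
  rewrite -sqrtr_sqr; apply: ler_wsqrtr; rewrite -expr2 lerDl -expr2; exact: sqr_ge0.
rewrite [leLHS]/Num.norm/= mx_normrE.
apply: bigmax_le => [|[i j] _ /=]; first exact: enorm_ge0.
rewrite /enorm dotE !ord1; case: (unliftP ord_max j) => [k|] ->.
  rewrite ord1; have -> : lift ord_max ord0 = ord0 :> 'I_2 by exact: val_inj.
  exact: h.
by rewrite addrC; exact: h.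
Qed.

Lemma enorm_le u : enorm u <= 2 * `|u|.
Proof.
have hx : `|cx u| <= `|u| by rewrite [leRHS]/Num.norm/= mx_normrE;
  apply: (le_bigmax _ (fun i : 'I_1 * 'I_2 => `|u i.1 i.2|) (ord0, ord0)).
have hy : `|cy u| <= `|u| by rewrite [leRHS]/Num.norm/= mx_normrE;
  apply: (le_bigmax _ (fun i : 'I_1 * 'I_2 => `|u i.1 i.2|) (ord0, ord_max)).
rewrite -(@ler_pXn2r _ 2) ?nnegrE ?mulr_ge0 ?enorm_ge0//.
rewrite enorm_sqr dotE -!expr2 -(real_normK (num_real (cx u))) -(real_normK
  (num_real (cy u))).
have := normr_ge0 (cx u); have := normr_ge0 (cy u).
rewrite exprMn; nra.
Qed.

(** The bridge from the sup-norm topology to Euclidean balls: the two norms differ by a factor of at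
    most 2. *)
Lemma nbhs_enormP p A : nbhs p A <->
  exists2 e : R, 0 < e & forall q, enorm (q - p) < e -> A q.
Proof.
split=> [/nbhs_ballP[e /= e0 eA]|[e e0 eA]].
  exists e => // q qp; apply: eA; rewrite -ball_normE /=.
  by rewrite -opprB normrN (le_lt_trans (normE_le _)).
apply/nbhs_ballP; exists (e / 2) => /=; first by rewrite divr_gt0.
move=> q; rewrite -ball_normE /= -opprB normrN => h; apply: eA.
by rewrite (le_lt_trans (enorm_le _))// mulrC -ltr_pdivlMr.
Qed.

Lemma interior_enormP A p : interior A p <->
  exists2 e : R, 0 < e & forall q, enorm (q - p) < e -> A q.
Proof. exact: nbhs_enormP. Qed.

Lemma continuous_cx : continuous cx.
Proof. exact: coord_continuous. Qed.
Lemma continuous_cy : continuous cy.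
Proof. exact: coord_continuous. Qed.

Section Continuity.
Variables (T : topologicalType) (x : T).

Lemma continuous_vec (f g : T -> R) : {for x, continuous f} ->
  {for x, continuous g} -> {for x, continuous (fun t => vec (f t) (g t))}.
Proof.
move=> cf cg.
have -> : (fun t => vec (f t) (g t)) = (fun t => f t *: vec 1 0 + g t *: vec 0 1).
  by apply/funext => t; apply: planeP; rewrite !coordE; ring.
by apply: cvgD; apply: continuousZr_tmp.
Qed.

Lemma continuous_coord (f : T -> plane R) : {for x, continuous f} ->
  {for x, continuous (cx \o f)} /\ {for x, continuous (cy \o f)}.
Proof.
move=> cf; split; apply: continuous_comp => //.
  exact: continuous_cx.
exact: continuous_cy.
Qed.

Lemma continuous_dot (f g : T -> plane R) : {for x, continuous f} ->
  {for x, continuous g} -> {for x, continuous (fun t => dot (f t) (g t))}.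
Proof.
move=> /continuous_coord[cf1 cf2] /continuous_coord[cg1 cg2].
have -> : (fun t => dot (f t) (g t)) =
    (fun t => (cx \o f) t * (cx \o g) t + (cy \o f) t * (cy \o g) t).
  by apply/funext => t; rewrite dotE.
by apply: continuousD; apply: continuousM.
Qed.

Lemma continuous_enorm (f : T -> plane R) : {for x, continuous f} ->
  {for x, continuous (fun t => enorm (f t))}.
Proof.
move=> cf; apply: (@continuous_comp _ _ _ (fun t => dot (f t) (f t)) Num.sqrt).
  exact: continuous_dot.
exact: sqrt_continuous.
Qed.

End Continuity.
End PlaneGeometry.
Arguments cx {R} u.
Arguments cy {R} u.
Arguments enorm {R} u.

(** * Invariance of domain in the plane *)

Section InvarianceOfDomain.
Variable R : realType.
Local Notation V := (R^o * R^o)%type.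

Definition cis (t : R) : plane R := vec (cos t) (sin t).

Lemma enorm_cis t : enorm (cis t) = 1.
Proof. by rewrite /enorm dotE !coordE -!expr2 cos2Dsin2 sqrtr1. Qed.

Lemma continuous_cis : continuous cis.
Proof.
by move=> t; apply: continuous_vec; [exact: continuous_cos|exact: continuous_sin].
Qed.

Lemma cisDpi t : cis (t + pi) = - cis t.
Proof. by apply: planeP; rewrite !coordE ?cosDpi ?sinDpi. Qed.

Variable h : plane R -> plane R.
Hypotheses (ch : continuous h) (h0 : h 0 = 0).
Hypothesis inj_h :
  forall x y, enorm x <= 1 -> enorm y <= 1 -> h x = h y -> x = y.

Let ramp_a (t : R) : R := Num.min t 1.
Let ramp_b (t : R) : R := Num.max (t - 2) 0.
Let ramp_c (t : R) : R := Num.max (Num.min (2 - t) 1) 0.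

(* A homotopy from the constant loop [- w] to the odd loop
   [h (cis u) - h (- cis u)]. *)
Let loop (w : plane R) (u t : R) : plane R :=
  h (ramp_a t *: cis u) - h (- ramp_b t *: cis u) - ramp_c t *: w.

Lemma continuous_loop w : continuous (fun x : V => loop w x.1 x.2).
Proof.
have c1 : continuous (fun x : V => cis x.1).
  move=> x; apply: (@continuous_comp _ _ _ fst cis); first exact: cvg_fst.
  exact: continuous_cis.
have c2 (f : R -> R) : continuous f -> continuous (fun x : V => f x.2).
  move=> cf x; apply: (@continuous_comp _ _ _ snd f); first exact: cvg_snd.
  exact: cf.
have cid : continuous (fun t : R => t) by move=> t; exact: cvg_id.
have ca : continuous ramp_a.
  move=> t; apply: (@continuous_min R R id (fun=> 1)); first exact: cid.
  exact: cst_continuous.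
have cb : continuous ramp_b.
  move=> t; apply: (@continuous_max R R (fun t => t - 2) (fun=> 0)).
    by apply: continuousB; [exact: cid|exact: cst_continuous].
  exact: cst_continuous.
have cc : continuous ramp_c.
  move=> t.
  apply: (@continuous_max R R (fun t => Num.min (2 - t) 1) (fun=> 0)).
    apply: (@continuous_min R R (fun t => 2 - t) (fun=> 1)).
      by apply: continuousB; [exact: cst_continuous|exact: cid].
    exact: cst_continuous.
  exact: cst_continuous.
move=> x; rewrite /loop.
apply: (@continuousB _ _ _ (fun x : V => h (ramp_a x.2 *: cis x.1) - h (-
  ramp_b x.2 *: cis x.1))
  (fun x : V => ramp_c x.2 *: w)); last first.
  by apply: continuousZr_tmp; exact: (c2 _ cc).
apply: continuousB.
  apply: (@continuous_comp _ _ _ _ h); last exact: ch.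
  by apply: continuousZ; [exact: (c2 _ ca)|exact: c1].
apply: (@continuous_comp _ _ _ _ h); last exact: ch.
by apply: continuousZ; [apply: continuousN; exact: (c2 _ cb)|exact: c1].
Qed.

(** Three phases. Up to time 1 the loop is a value of [h] minus [w]; up to time 2 the multiple of
    [w] shrinks to 0 and stays shorter than [h (cis u)]; up to time 3 it is a difference of values
    of [h] at points on opposite rays, and injectivity applies. *)
Lemma loop_neq0 w (u t : R) : enorm w < enorm (h (cis u)) ->
  (forall y, enorm y <= 1 -> h y != w) -> 0 <= t <= 3 -> loop w u t != 0.
Proof.
move=> small notin /andP[t0 t3].
have eZ (k : R) : 0 <= k <= 1 -> enorm (k *: cis u) <= 1.
  by move=> /andP[k0 k1]; rewrite enormZ enorm_cis mulr1 ger0_norm.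
rewrite /loop /ramp_a /ramp_b /ramp_c.
have [t1|t1] := leP t 1.
  have /max_idPr -> : t - 2 <= 0 by lra.
  have /min_idPr -> : 1 <= 2 - t by lra.
  have /max_idPl -> : 0 <= 1 :> R by lra.
  by rewrite oppr0 scale0r h0 subr0 scale1r subr_eq0 notin// eZ// t0.
have [t2|t2] := leP t 2.
  have /max_idPr -> : t - 2 <= 0 by lra.
  have /min_idPl -> : 2 - t <= 1 by lra.
  have /max_idPl -> : 0 <= 2 - t by lra.
  rewrite oppr0 scale0r h0 subr0 scale1r subr_eq0; apply/eqP => e.
  move: small; rewrite e enormZ ltNge => /negP; apply.
  rewrite ger0_norm; last lra.
  by rewrite ler_piMl ?enorm_ge0//; lra.
have /max_idPl -> : 0 <= t - 2 by lra.
have /min_idPl -> : 2 - t <= 1 by lra.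
have /max_idPr -> : 2 - t <= 0 by lra.
rewrite scale0r subr0 scale1r subr_eq0; apply/eqP => /inj_h e.
have : cis u = - (t - 2) *: cis u.
  apply: e; first by rewrite enorm_cis.
  by rewrite scaleNr enormN eZ//; lra.
rewrite -{1}[cis u]scale1r => /eqP; rewrite -subr_eq0 -scalerBl scaler_eq0.
rewrite -enorm_eq0 enorm_cis oner_eq0 orbF => /eqP; lra.
Qed.

(* If a small [w] is not a value of [h], the lifted angle of [loop w] has zero
   total variation around the circle at time 0, hence at time 3, where it should
   be an odd multiple of [2 * pi]. *)
Lemma interior_image_unit_disc : interior (h @` [set x | enorm x <= 1]) 0.
Proof.
have pi0 := pi_gt0 R; have pi2 : 0 <= 2 * pi :> R by lra.
(* The minimal length of [h] on the unit circle is the radius of the ball to be covered. *)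
have [v vI vmin] : exists2 v, v \in `[0, 2 * pi] &
    forall u, u \in `[0, 2 * pi] -> enorm (h (cis v)) <= enorm (h (cis u)).
  apply: EVT_min => //; apply: continuous_subspaceT => u.
  apply: continuous_enorm; apply: (@continuous_comp _ _ _ cis h); last exact: ch.
  exact: continuous_cis.
apply/interior_enormP; exists (enorm (h (cis v))) => [|w].
  rewrite enorm_gt0 -h0; apply/eqP => /inj_h e.
  have : cis v = 0 by apply: e; rewrite ?enorm_cis// enorm0.
  by move/eqP; rewrite -enorm_eq0 enorm_cis oner_eq0.
rewrite subr0 => small; apply: contrapT => notin.
have {notin} notin y : enorm y <= 1 -> h y != w.
  by move=> y1; apply/eqP => hy; apply: notin; exists y.
have {vmin small} small u : u \in `[0, 2 * pi] -> enorm w < enorm (h (cis u)).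
  by move=> /vmin; exact: lt_le_trans.
pose A : set V := `[0, 2 * pi] `*` `[0, 3].
pose X (u t : R) : R := cx (loop w u t); pose Y (u t : R) : R := cy (loop w u t).
have [|||||al alP] := @angle_lift R V (fun x => X x.1 x.2) (fun x => Y x.1 x.2) A.
- by move=> x; have [] := continuous_coord (@continuous_loop w x).
- by move=> x; have [] := continuous_coord (@continuous_loop w x).
- by apply: compact_setX; exact: segment_compact.
- move=> x t [] /=; rewrite !in_itv/= => /andP[x1 x2] /andP[x3 x4] /andP[t0 t1].
  by split; rewrite /= in_itv/=; apply/andP; split; rewrite /GRing.scale/=; nra.
- move=> x [/= x1]; rewrite in_itv/= => x3.
  have := loop_neq0 (small _ x1) notin x3; apply: contraR.
  rewrite negb_or !negbK => /andP[/eqP e1 /eqP e2]; apply/eqP.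
  by apply: planeP; rewrite ?[LHS]e1 ?[LHS]e2 coordE.
pose be (u t : R) : R := al (u, t).
have inA (u t : R) : 0 <= u <= 2 * pi -> 0 <= t <= 3 -> A (u, t).
  by split; rewrite /= in_itv.
have calu (u t : R) : 0 <= u <= 2 * pi -> 0 <= t <= 3 ->
    {for u, continuous (be^~ t)}.
  move=> uI tI; apply: (@continuous_comp _ _ _ (fun u : R => (u, t) : V) al).
    by apply: (@cvg_pair _ _ _ _ (nbhs (u : R^o)) (nbhs (t : R^o)));
      [exact: cvg_id|exact: cvg_cst].
  by have [] := alP _ (inA _ _ uI tI).
have calt (u t : R) : 0 <= u <= 2 * pi -> 0 <= t <= 3 ->
    {for t, continuous (be u)}.
  move=> uI tI; apply: (@continuous_comp _ _ _ (fun t : R => (u, t) : V) al).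
    by apply: (@cvg_pair _ _ _ _ (nbhs (u : R^o)) (nbhs (t : R^o)));
      [exact: cvg_cst|exact: cvg_id].
  by have [] := alP _ (inA _ _ uI tI).
have angP (u t : R) : 0 <= u <= 2 * pi -> 0 <= t <= 3 ->
    has_angle (X u t) (Y u t) (be u t).
  by move=> uI tI; have [] := alP _ (inA _ _ uI tI).
(* At time 0 the loop is constantly [- w]. *)
have al0 : be 0 0 = be (2 * pi) 0.
  apply: (@continuous_angle_const _ (fun u => be u 0) _ _
    (cos (be 0 0)) (sin (be 0 0))) => // u uI; first by apply: calu => //; lra.
  apply: (@has_angle_uniq _ (X 0 0) (Y 0 0)); last by apply: angP; lra.
  have e : loop w 0 0 = loop w u 0.
    have ra : ramp_a 0 = 0 by apply/min_idPl; lra.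
    have rb : ramp_b 0 = 0 by apply/max_idPr; lra.
    by rewrite /loop ra rb oppr0 !scale0r.
  by rewrite /X /Y /= e; apply: angP => //; lra.
have rot (t : R) (tI : 0 <= t <= 3) : cos (be (2 * pi) t) = cos (be 0 t) /\ sin
  (be (2 * pi) t) = sin (be 0 t).
  apply: (@has_angle_uniq _ (X 0 t) (Y 0 t)); last by apply: angP; lra.
  have e : cis (2 * pi) = cis 0.
    by rewrite mulr_natl; apply: planeP; rewrite !coordE ?cos2pi ?sin2pi ?cos0 ?sin0.
  by rewrite /X /Y /= /loop /= -e; apply: angP => //; lra.
(* The variation around the circle is a multiple of [2 * pi] at each time, so it is constant in
   time. *)
have al3 : be (2 * pi) 0 - be 0 0 = be (2 * pi) 3 - be 0 3.
  apply: (@continuous_angle_const _ (fun t => be (2 * pi) t - be 0 t) _ _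
    1 0); [lra|move=> t tI|move=> t tI].
    by apply: continuousB; apply: calt => //; lra.
  rewrite cosB sinB (rot t tI).1 (rot t tI).2 -!expr2 cos2Dsin2.
  by split=> //; rewrite mulrC subrr.
have odd (u : R) (uI : 0 <= u <= pi) : cos (be (u + pi) 3) = - cos (be u 3) /\
    sin (be (u + pi) 3) = - sin (be u 3).
  rewrite -cosDpi -sinDpi.
  apply: (@has_angle_uniq _ (X (u + pi) 3) (Y (u + pi) 3)).
    by apply: angP; lra.
  have e : loop w (u + pi) 3 = - loop w u 3.
    have ra : ramp_a 3 = 1 by apply/min_idPr; lra.
    have rb : ramp_b 3 = 1 by rewrite /ramp_b (_ : 3 - 2 = 1); [apply/max_idPl;
      exact: ler01|lra].
    have rc : ramp_c 3 = 0 by apply/max_idPr; rewrite ge_min; apply/orP; left;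
      rewrite subr_le0 ler_nat.
    by rewrite /loop ra rb rc !scale0r !subr0 !scaleN1r !scale1r cisDpi opprK opprB.
  have := has_angle_rot pi (angP u 3 ltac:(lra) ltac:(lra)).
  by rewrite cospi sinpi /X /Y /= e !coordE !mulN1r !mul0r subr0 add0r.
(* By oddness both half-circles contribute the same variation at time 3. The total is 0, so each
   contributes 0, although opposite points have opposite cosines and sines. *)
have : be (0 + pi) 3 - be 0 3 = be (pi + pi) 3 - be pi 3.
  apply: (@continuous_angle_const _ (fun u => be (u + pi) 3 - be u 3) _ _
    (-1) 0); [lra|move=> u uI|move=> u uI].
    apply: continuousB; last by apply: calu; lra.
    apply: (@continuous_comp _ _ _ (fun u => u + pi) (fun u => be u 3)).
      by apply: continuousD; [exact: cvg_id|exact: cvg_cst].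
    by apply: calu; lra.
  rewrite cosB sinB (odd u uI).1 (odd u uI).2 !mulNr -opprD -!expr2 cos2Dsin2.
  by split=> //; rewrite mulrC subrr.
have e2 : pi + pi = 2 * pi :> R by ring.
rewrite add0r e2 => e.
have [c0 s0] := odd 0 ltac:(lra); have := rot 3 ltac:(lra); move: c0 s0.
rewrite add0r => c0 s0 _.
have e0 : be pi 3 = be 0 3 by lra.
move: c0 s0; rewrite e0 => c0 s0.
have := cos2Dsin2 (be 0 3); have -> : cos (be 0 3) = 0 by lra.
have -> : sin (be 0 3) = 0 by lra.
by rewrite expr0n/= addr0 => /eqP; rewrite eq_sym oner_eq0.
Qed.

End InvarianceOfDomain.

(** * Topological discs *)

Section TopologicalDiscs.
Variable R : realType.
Implicit Types (x y c : plane R) (D : set (plane R)).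

(** The case of the unit disc, after rescaling the source and translating the target. *)
Lemma interior_image_disc (h : plane R -> plane R) c (r : R) : 0 < r ->
  continuous h ->
  (forall x y, enorm (x - c) <= r -> enorm (y - c) <= r -> h x = h y -> x = y) ->
  interior (h @` [set x | enorm (x - c) <= r]) (h c).
Proof.
move=> r0 ch injh; pose h' x := h (c + r *: x) - h c.
have ch' : continuous h'.
  move=> x; apply: continuousB; last exact: cst_continuous.
  apply: (@continuous_comp _ _ _ (fun x => c + r *: x) h); last exact: ch.
  by apply: continuousD; [exact: cst_continuous|exact: scaler_continuous].
have e x : enorm (c + r *: x - c) = r * enorm x.
  by rewrite addrC addKr enormZ gtr0_norm.
have [|x y x1 y1 /addIr xy|s s0 sP] :=
    (interior_enormP _ _).1 (interior_image_unit_disc ch' _ _).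
- by rewrite /h' scaler0 addr0 subrr.
- have : c + r *: x = c + r *: y.
    by apply: injh => //; rewrite e ler_piMr// ltW.
  by move/addrI/(scalerI (lt0r_neq0 r0)).
- apply/interior_enormP; exists s => // q qs.
  have [|x /= x1 xq] := sP (q - h c); first by rewrite subr0.
  by exists (c + r *: x); [rewrite /= e ler_piMr// ltW|apply: (addIr (- h c))].
Qed.

Lemma continuous_comp_within (T U W : topologicalType) (A : set U)
    (h : T -> U) (f : U -> W) :
  continuous h -> {within A, continuous f} -> (forall t, A (h t)) ->
  continuous (f \o h).
Proof.
move=> ch /subspace_continuousP cf hA t.
apply: (@cvg_comp _ _ _ h f _ (within A (nbhs (h t)))); last exact: cf.
move=> B; rewrite /within /= => wB; near=> y.
by have : A (h y) by []; near: y; exact: ch wB.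
Unshelve. all: by end_near. Qed.

Definition retr x : plane R := (Num.max 1 (enorm x))^-1 *: x.

Lemma enorm_retr x : enorm (retr x) <= 1.
Proof.
have m0 : 0 < Num.max 1 (enorm x) by rewrite lt_max ltr01.
by rewrite enormZ gtr0_norm ?invr_gt0// mulrC ler_pdivrMr// mul1r le_max lexx orbT.
Qed.

Lemma retr_id x : enorm x <= 1 -> retr x = x.
Proof. by move=> /max_idPl; rewrite /retr => ->; rewrite invr1 scale1r. Qed.

Lemma continuous_retr : continuous retr.
Proof.
move=> x; rewrite /retr.
apply: (@continuousZ _ _ _ (fun x => (Num.max 1 (enorm x))^-1) id);
  last exact: cvg_id.
apply: (@continuousV _ _ (fun x => Num.max 1 (enorm x)));
  first by rewrite gt_eqF// lt_max ltr01.
apply: (@continuous_max R _ (fun=> 1) enorm); first exact: cst_continuous.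
by apply: continuous_enorm; exact: cvg_id.
Qed.

(* [f] is defined on the whole plane: a homeomorphism from the unit disc to [D]
   composed with the radial retraction [retr]. *)
Record disc_param D (f k : plane R -> plane R) : Prop := DiscParam {
  dp_cont : continuous f;
  dp_in : forall x, enorm x <= 1 -> D (f x);
  dp_fK : forall x, enorm x <= 1 -> k (f x) = x;
  dp_kin : forall y, D y -> enorm (k y) <= 1;
  dp_kK : forall y, D y -> f (k y) = y;
  dp_kcont : {within D, continuous k} }.

Lemma topological_disc_param D : topological_disc D -> exists f k, disc_param D f k.
Proof.
move=> [f [k [cf ck [fD kD] fK kK]]].
have dE x : unit_disc x <-> enorm x <= 1 by rewrite /unit_disc /= distE subr0.
exists (f \o retr), k; split=> //=.
- apply: continuous_comp_within continuous_retr cf _ => x.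
  by apply/dE/enorm_retr.
- by move=> x x1; apply: fD; exists (retr x) => //; apply/dE/enorm_retr.
- by move=> x x1; rewrite retr_id//; apply: fK; apply/dE.
- by move=> y Dy; apply/dE; apply: kD; exists y.
- by move=> y Dy; rewrite retr_id ?kK//; apply/dE; apply: kD; exists y.
Qed.

Section Param.
Variables (D : set (plane R)) (f k : plane R -> plane R).
Hypothesis dp : disc_param D f k.

(** Invariance of domain on the closed disc of radius [1 - enorm x] around [x], where [k] witnesses
    the injectivity of [f]. *)
Lemma disc_param_interior x : enorm x < 1 -> interior D (f x).
Proof.
move=> x1; have r0 : 0 < 1 - enorm x by rewrite subr_gt0.
have in1 y : enorm (y - x) <= 1 - enorm x -> enorm y <= 1.
  by move=> h; have := ler_enormD (y - x) x; rewrite subrK; lra.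
have := @interior_image_disc f x (1 - enorm x) r0 (dp_cont dp).
have inj y z : enorm (y - x) <= 1 - enorm x -> enorm (z - x) <= 1 - enorm x ->
    f y = f z -> y = z.
  by move=> /in1 y1 /in1 z1 /(congr1 k); rewrite !(dp_fK dp).
move=> /(_ inj); apply: (interiorS _) => _ [y /= /in1 y1 <-].
exact: (dp_in dp).
Qed.

Lemma disc_param_boundary p : D p -> ~ interior D p -> enorm (k p) = 1.
Proof.
move=> Dp nint; apply/eqP; rewrite eq_le (dp_kin dp)//= leNgt.
by apply/negP => /disc_param_interior; rewrite (dp_kK dp).
Qed.

Lemma disc_param_compact : compact D.
Proof.
have <- : f @` [set x | enorm x <= 1] = D.
  apply/seteqP; split=> [_ [x x1 <-]|y Dy]; first exact: (dp_in dp).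
  by exists (k y); [exact: (dp_kin dp)|exact: (dp_kK dp)].
apply: continuous_compact; first by apply: continuous_subspaceT => x;
  exact: (dp_cont dp).
apply: bounded_closed_compact.
  exists 1; split=> // M M1 x /= x1.
  by rewrite (le_trans (normE_le _))// (le_trans x1)// ltW.
apply: (@closed_comp _ _ (fun x : plane R => enorm x) [set t | t <= 1]) => [x _|].
  by apply: continuous_enorm; exact: cvg_id.
exact: closed_le.
Qed.

(** The parameter [k p] is shrunk slightly towards the origin: it enters the open unit disc, and
    continuity of [f] keeps its image near [p]. *)
Lemma disc_param_closure_interior p : D p ->
  forall e : R, 0 < e -> exists2 q, interior D q & enorm (q - p) < e.
Proof.
move=> Dp e e0.
have /nbhs_enormP[d d0 dP] : nbhs (k p) [set x | enorm (f x - p) < e].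
  have : nbhs (f (k p)) [set y | enorm (y - p) < e].
    by apply/nbhs_enormP; exists e; rewrite // (dp_kK dp).
  exact: (dp_cont dp).
pose t := Num.min (d / 2) (1 / 2).
have t0 : 0 < t by rewrite lt_min !divr_gt0.
have td : t < d by rewrite gt_min; apply/orP; left; lra.
have t1 : t <= 1 / 2 by rewrite ge_min lexx orbT.
have k1 := dp_kin dp Dp; have k0 := enorm_ge0 (k p).
exists (f ((1 - t) *: k p)).
  apply: disc_param_interior; rewrite enormZ ger0_norm; last lra.
  nra.
apply: dP; rewrite scalerBl scale1r addrC addKr enormN enormZ gtr0_norm//.
nra.
Qed.

End Param.
End TopologicalDiscs.

(** * Convex discs *)

Section ConvexBodies.
Variable R : realType.
Implicit Types (x y z p q d u n : plane R) (K : set (plane R)).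

Lemma disc_closed K : convex_disc K -> closed K.
Proof. by move=> [cK _ _]; apply: compact_closed => //; exact: norm_hausdorff. Qed.

Lemma disc_conv K x y (t : R) : convex_disc K -> K x -> K y -> 0 <= t <= 1 ->
  K ((1 - t) *: x + t *: y).
Proof.
move=> [_ cK _] Kx Ky /andP[t0 t1].
have s0 : 0 <= 1 - t by rewrite subr_ge0.
have s1 : 1 - t <= 1 by rewrite gerBl.
have := cK x y (Itv01 s0 s1); rewrite !inE => /(_ Kx Ky).
by rewrite /conv/= /unstable.onem subKr.
Qed.

Lemma convex_discP K : compact K ->
  (forall x y (t : R), K x -> K y -> 0 <= t <= 1 -> K ((1 - t) *: x + t *: y)) ->
  interior K !=set0 -> convex_disc K.
Proof.
move=> cK convK intK; split=> // x y l /[!inE] Kx Ky.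
have := convK x y (1 - l%:num) Kx Ky.
rewrite subr_ge0 le1 gerBl ge0 => /(_ isT).
by rewrite /conv/= /unstable.onem subKr.
Qed.

(** The homothety with centre [x] and ratio [t] maps a ball around [z] in [K] to a ball in [K]
    around the combination. *)
Lemma interior_conv K x z (t : R) : convex_disc K -> K x -> interior K z ->
  0 < t <= 1 -> interior K ((1 - t) *: x + t *: z).
Proof.
move=> dK Kx /interior_enormP[e e0 eK] /andP[t0 t1].
apply/interior_enormP; exists (t * e); first exact: mulr_gt0.
move=> q qe; pose w := t^-1 *: (q - ((1 - t) *: x + t *: z)).
have -> : q = (1 - t) *: x + t *: (z + w).
  rewrite scalerDr /w scalerA mulfV ?gt_eqF// scale1r.
  by rewrite addrA addrC subrK.
apply: disc_conv => //; last by rewrite (ltW t0).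
apply: eK; rewrite addrC addKr /w enormZ gtr0_norm ?invr_gt0//.
by rewrite mulrC ltr_pdivrMr// mulrC.
Qed.

(** Otherwise the parameters of interior points would form a nonempty subset of [[0, 1]] that is
    both open and closed, hence all of it, against the choice of [y]. *)
Lemma boundary_on_segment K x y : closed K -> interior K x -> ~ interior K y ->
  exists2 t : R, 0 <= t <= 1 & boundary K ((1 - t) *: x + t *: y).
Proof.
move=> clK intx nint; apply: contrapT => nobd.
pose s t := (1 - t) *: x + t *: y.
have cs : continuous s.
  move=> t; apply: (@continuousD R (plane R) R^o (fun t : R^o => (1 - t) *: x)
    (fun t : R^o => t *: y)).
    apply: (@continuousZr_tmp R _ R^o (fun t : R^o => 1 - t)).
    by apply: (@continuousB R R^o R^o (fun=> 1));
      [exact: cst_continuous|exact: cvg_id].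
  by apply: (@continuousZr_tmp R _ R^o id); exact: cvg_id.
have KI t : 0 <= t <= 1 -> K (s t) -> interior K (s t).
  move=> tI Ks; apply: contrapT => ni; apply: nobd; exists t => //; split=> //.
  exact: subset_closure.
have h := @segment_connected R 0 1 (`[0, 1]%classic `&` s @^-1` interior K).
have : (`[0, 1]%classic `&` s @^-1` interior K) 1.
  rewrite h.
  - by rewrite /= in_itv/= lexx ler01.
  - exists 0; split; first by rewrite /= in_itv/= lexx ler01.
    by rewrite /= /s subr0 scale1r scale0r addr0.
  - exists (s @^-1` interior K) => //.
    by apply: open_comp; [move=> t _; exact: cs|exact: open_interior].
  - exists (s @^-1` K); first by apply: closed_comp => // t _; exact: cs.
    apply/seteqP; split=> t [tI st]; split=> //=.
      exact: (interior_subset st).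
    by apply: KI => //; move: tI; rewrite /= in_itv.
by move=> [_]; rewrite /= /s subrr scale0r scale1r add0r.
Qed.

(** A single radius suffices: for [p] in a convex disc, [innerP] passes to all smaller ones. *)
Definition inner K p d := exists2 r : R, 0 < r & interior K (p + r *: d).

Lemma innerP K p d : convex_disc K -> K p -> inner K p d ->
  exists2 r0 : R, 0 < r0 & forall r, 0 < r <= r0 -> interior K (p + r *: d).
Proof.
move=> dK Kp [r0 r0_gt0 h]; exists r0 => // r /andP[r_gt0 rr0].
have -> : p + r *: d = (1 - r / r0) *: p + (r / r0) *: (p + r0 *: d).
  rewrite scalerDr scalerA divfK ?gt_eqF// addrA -scalerDl.
  by rewrite subrK scale1r.
by apply: interior_conv => //; rewrite divr_gt0//= ler_pdivrMr// mul1r.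
Qed.

(** Tangency at [p] to the line through [p] orthogonal to [n], expressed by dot products. *)
Definition flat_at K p n := forall e : R, 0 < e -> exists2 dl : R, 0 < dl &
  forall q, boundary K q -> enorm (q - p) < dl ->
    `|dot (q - p) n| <= e * enorm (q - p).

(* The boundary does not meet a sector avoiding the tangent line, so either all
   directions on one side of that line enter [K] or none does. *)
Lemma flat_inner K p n d d' : convex_disc K -> K p -> flat_at K p n ->
  0 < dot d n -> 0 < dot d' n -> inner K p d -> inner K p d'.
Proof.
move=> dK Kp flat dn dn' /(innerP dK Kp)[r0 r0_gt0 ind].
apply: contrapT => nind.
(* A boundary point between [p + r *: d] and [p + r *: d'] has distance at most [r * M] from [p] and
   normal component at least [r * c]; flatness with constant [c / (2 * M)] would allow only half of
   that. *)
pose c := Num.min (dot d n) (dot d' n); pose M := enorm d + enorm d'.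
have c0 : 0 < c by rewrite lt_min dn dn'.
have M0 : 0 < M.
  rewrite ltr_wpDr ?enorm_ge0// enorm_gt0; apply: contraTneq dn => ->.
  by rewrite dot0l ltxx.
have e0 : 0 < c / (2 * M) by rewrite divr_gt0// mulr_gt0.
have [dl dl0 dlP] := flat _ e0.
pose r := Num.min r0 (dl / (2 * M)).
have r_gt0 : 0 < r by rewrite lt_min r0_gt0 divr_gt0// mulr_gt0.
have rdl : r * M < dl.
  have : r <= dl / (2 * M) by rewrite ge_min lexx orbT.
  by rewrite ler_pdivlMr ?mulr_gt0//; lra.
have [|||t tI bd] := @boundary_on_segment K (p + r *: d) (p + r *: d').
- exact: disc_closed.
- by apply: ind; rewrite r_gt0 ge_min lexx.
- by move=> h; apply: nind; exists r.
have {bd} := dlP _ bd.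
have -> : (1 - t) *: (p + r *: d) + t *: (p + r *: d') - p =
    r *: ((1 - t) *: d + t *: d').
  by apply: planeP; rewrite !coordE; ring.
have /andP[t0 t1] := tI.
have le_M : enorm ((1 - t) *: d + t *: d') <= M.
  rewrite (le_trans (ler_enormD _ _))// !enormZ !ger0_norm//; last lra.
  by have := enorm_ge0 d; have := enorm_ge0 d'; rewrite /M; nra.
have ge_c : c <= dot ((1 - t) *: d + t *: d') n.
  rewrite dotDl !dotZl.
  have : c <= dot d n by rewrite ge_min lexx.
  have : c <= dot d' n by rewrite ge_min lexx orbT.
  nra.
rewrite enormZ dotZl !(gtr0_norm r_gt0) => h.
have rM : r * enorm ((1 - t) *: d + t *: d') <= r * M by rewrite ler_pM2l.
have {}h := h (le_lt_trans rM rdl).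
have : r * c <= c / (2 * M) * (r * M).
  rewrite (le_trans _ (le_trans h _))//.
    by rewrite (le_trans _ (ler_norm _))// ler_pM2l.
  by rewrite ler_pM2l.
have -> : c / (2 * M) * (r * M) = r * c / 2 by field; rewrite gt_eqF.
by have := mulr_gt0 r_gt0 c0; lra.
Qed.

(** The vector [n] is the direction of the tangent line turned by a right angle, and the normal
    component of [q - p] is controlled by the distance of [q] from that line. *)
Lemma smooth_flat K p : smooth K -> boundary K p ->
  exists2 n, n != 0 & flat_at K p n.
Proof.
move=> smK bp; have [L [[[a [u [u0 ->]]] [s _ sp] tan] _]] := smK p bp.
have n0 : vec (- cy u) (cx u) != 0.
  rewrite -dot_eq0 dotE !coordE; move: u0; rewrite -dot_eq0 dotE.
  by apply: contra_neq => <-; ring.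
exists (vec (- cy u) (cx u)) => // e e0.
set n := vec _ _ in n0 *.
have en0 : 0 < enorm n by rewrite enorm_gt0.
have e'0 : 0 < e / enorm n by rewrite divr_gt0.
have /nbhs_enormP[dl dl0 dlP] := tan _ e'0.
exists dl => // q bq /dlP /(_ bq)[_ [t _ <-]].
rewrite !distE => h.
have -> : dot (q - p) n = dot (q - (a + t *: u)) n.
  by rewrite -sp !dotE !coordE; ring.
rewrite (le_trans (cauchy_schwarz_norm _ _))//.
rewrite (_ : e = e / enorm n * enorm n); last by rewrite divfK// gt_eqF.
by rewrite mulrAC ler_pM2r.
Qed.

(** The tangent line supports [K] and, by strict convexity, touches it only at [p]; by [flat_inner]
    one inward direction makes all directions of its open half-plane inward. *)
Lemma smooth_support K p : convex_disc K -> strictly_convex K -> smooth K ->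
  boundary K p -> exists2 n, n != 0 &
    (forall x, K x -> x != p -> 0 < dot (x - p) n) /\
    (forall d, 0 < dot d n -> inner K p d).
Proof.
move=> dK stK smK bp; have [n n0 flat] := smooth_flat smK bp.
have Kp : K p by move: bp => [+ _]; rewrite -(closure_id _).1//; exact: disc_closed.
have nip : ~ interior K p by case: bp.
(* The sign of [n] is chosen by an interior point off the tangent line; an interior point on the
   line is first moved off it along [n]. *)
wlog [z iz zn] : n n0 flat / exists2 z, interior K z & 0 < dot (z - p) n.
  move=> W.
  have [z iz zn] : exists2 z, interior K z & dot (z - p) n != 0.
    have [_ _ [z0 iz0]] := dK; have := iz0 => /interior_enormP[e e0 eK].
    have [z0n|] := eqVneq (dot (z0 - p) n) 0; last by exists z0.
    have en0 : 0 < enorm n by rewrite enorm_gt0.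
    pose s := e / (2 * enorm n).
    have s0 : 0 < s by rewrite divr_gt0// mulr_gt0.
    have se : s * enorm n < e.
      by rewrite /s (_ : _ * _ = e / 2); [lra|field; rewrite gt_eqF].
    exists (z0 + s *: n); last first.
      by rewrite addrAC dotDl z0n add0r dotZl mulf_neq0 ?gt_eqF// dot_gt0.
    apply/interior_enormP; exists (e - s * enorm n); first by rewrite subr_gt0.
    move=> q qz; apply: eK.
    have := ler_enormD (q - (z0 + s *: n)) (s *: n).
    have -> : q - (z0 + s *: n) + s *: n = q - z0.
      by apply: planeP; rewrite !coordE; ring.
    by rewrite enormZ (gtr0_norm s0); lra.
  have [zn0|zn0|/eqP] := ltrgtP (dot (z - p) n) 0; last by rewrite (negPf zn).
    have [|||m m0 P] := W (- n).
    - by rewrite oppr_eq0.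
    - by move=> e e0; have [dl dl0 h] := flat e e0; exists dl => // q bq qd;
      rewrite dotNr normrN h.
    - by exists z => //; rewrite dotNr oppr_gt0.
    by exists m.
  by apply: W n0 flat _; exists z.
have inn d : 0 < dot d n -> inner K p d.
  move=> dn; apply: (flat_inner dK Kp flat zn dn).
  by exists 1 => //; rewrite scale1r addrC subrK.
have ge0 x : K x -> 0 <= dot (x - p) n.
  move=> Kx; rewrite leNgt; apply/negP => lt0.
  have [|r r0 ir] := inn (- (x - p)); first by rewrite dotNl oppr_gt0.
  (* Here [p] lies strictly between [x] and an interior point on the opposite ray, so it would be
     interior itself. *)
  apply: nip.
  have -> : p = (1 - (1 + r)^-1) *: x + (1 + r)^-1 *: (p + r *: - (x - p)).
    by apply: planeP; rewrite !coordE; field; rewrite gt_eqF//; lra.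
  have r1 : 0 < 1 + r by lra.
  by apply: interior_conv => //; rewrite invr_gt0 r1 invf_le1//; lra.
exists n => //; split=> // x Kx xp; rewrite lt_def ge0// andbT.
(* A second point [x] on the tangent line puts the whole segment in the boundary: an interior point
   of [K] on it would have neighbours in [K] on the wrong side. *)
apply/eqP => x0; apply: (stK p x); first by rewrite eq_sym.
move=> _ [t tI <-]; split.
  by apply: subset_closure; apply: disc_conv.
move=> /interior_enormP[e e0 eK].
have en0 : 0 < enorm n by rewrite enorm_gt0.
pose s := e / (2 * enorm n).
have s0 : 0 < s by rewrite divr_gt0// mulr_gt0.
have /ge0 : K ((1 - t) *: p + t *: x - s *: n).
  apply: eK; rewrite addrC addKr enormN enormZ (gtr0_norm s0).
  have -> : s * enorm n = e / 2 by rewrite /s; field; rewrite gt_eqF.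
  by lra.
have -> : (1 - t) *: p + t *: x - s *: n - p = t *: (x - p) - s *: n.
  by apply: planeP; rewrite !coordE; ring.
rewrite dotDl dotNl !dotZl x0 mulr0 sub0r oppr_ge0 leNgt.
by rewrite mulr_gt0// dot_gt0.
Qed.

End ConvexBodies.

(** * Isometries *)

Section Isometries.
Variable R : realType.
Implicit Types (x y p q c : plane R) (a b s : R).

(* With [a ^+ 2 + b ^+ 2 = 1], a rotation for [s = 1] and a reflection for
   [s = -1]. *)
Definition lin a b s x : plane R :=
  vec (a * cx x - s * b * cy x) (b * cx x + s * a * cy x).

Lemma lin_linear a b s (t : R) x y :
  lin a b s (t *: x + y) = t *: lin a b s x + lin a b s y.
Proof. by apply: planeP; rewrite !coordE; ring. Qed.

Lemma dot_lin a b s x y : a ^+ 2 + b ^+ 2 = 1 -> s ^+ 2 = 1 ->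
  dot (lin a b s x) (lin a b s y) = dot x y.
Proof.
move=> ab s2; rewrite !dotE !coordE.
transitivity ((a ^+ 2 + b ^+ 2) * (cx x * cx y + s ^+ 2 * (cy x * cy y))).
  by ring.
by rewrite ab s2 !mul1r.
Qed.

Lemma lin_surj a b s y : a ^+ 2 + b ^+ 2 = 1 -> s ^+ 2 = 1 ->
  exists x, lin a b s x = y.
Proof.
move=> ab s2.
(* The transposed matrix applied to [y]. *)
exists (vec (a * cx y + b * cy y) (s * (a * cy y - b * cx y))).
apply: planeP; rewrite !coordE.
  transitivity (a * (a * cx y + b * cy y) - s ^+ 2 * b * (a * cy y - b * cx y)).
    by ring.
  rewrite s2; transitivity ((a ^+ 2 + b ^+ 2) * cx y); first by ring.
  by rewrite ab mul1r.
transitivity (b * (a * cx y + b * cy y) + s ^+ 2 * a * (a * cy y - b * cx y)).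
  by ring.
rewrite s2; transitivity ((a ^+ 2 + b ^+ 2) * cy y); first by ring.
by rewrite ab mul1r.
Qed.

(** After subtracting [g 0], polarization shows that dot products are preserved. The images of the
    two basis vectors are then orthonormal, [s] is their determinant, and the dot products with them
    give the coordinates of any image. *)
Lemma isometry_lin (g : plane R -> plane R) : euclidean_isometry g ->
  exists a b s, [/\ a ^+ 2 + b ^+ 2 = 1, s ^+ 2 = 1 &
    forall x, g x = lin a b s x + g 0].
Proof.
move=> isog; have [T TE] : exists T, forall x, T x = g x - g 0 by exists (fun x
  => g x - g 0).
have T2 x y : dot (T x - T y) (T x - T y) = dot (x - y) (x - y).
  by rewrite -!enorm_sqr !TE opprB addrA subrK -!distE isog.
have T0 : T 0 = 0 by rewrite TE subrr.
have T1 x : dot (T x) (T x) = dot x x by have := T2 x 0; rewrite T0 !subr0.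
have TT x y : dot (T x) (T y) = dot x y.
  have := T2 x y; rewrite !dotE_lin !T1 (dotC (T y)) (dotC y); lra.
pose e1 : plane R := vec 1 0; pose e2 : plane R := vec 0 1.
set a := cx (T e1); set b := cy (T e1).
set p := cx (T e2); set q := cy (T e2).
have := TT e1 e1; have := TT e2 e2; have := TT e1 e2.
rewrite !dotE !coordE -/a -/b -/p -/q => h12 h22 h11.
have ab : a ^+ 2 + b ^+ 2 = 1 by rewrite !expr2 h11; ring.
have pq : p ^+ 2 + q ^+ 2 = 1 by rewrite !expr2 h22; ring.
have {}h12 : a * p + b * q = 0 by rewrite h12; ring.
pose s := a * q - b * p.
have s2 : s ^+ 2 = 1.
  transitivity ((a ^+ 2 + b ^+ 2) * (p ^+ 2 + q ^+ 2) - (a * p + b * q) ^+ 2).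
    by rewrite /s; ring.
  by rewrite ab pq h12; ring.
have pE : p = - (s * b).
  transitivity ((a ^+ 2 + b ^+ 2) * p - a * (a * p + b * q));
    last by rewrite /s; ring.
  by rewrite ab h12; ring.
have qE : q = s * a.
  transitivity ((a ^+ 2 + b ^+ 2) * q - b * (a * p + b * q));
    last by rewrite /s; ring.
  by rewrite ab h12; ring.
exists a, b, s; split=> // x.
rewrite -[LHS](subrK (g 0)) -TE; congr (_ + _).
have := TT x e1; have := TT x e2; rewrite !dotE !coordE -/a -/b -/p -/q.
rewrite !mulr1 !mulr0 add0r addr0 pE qE => hy hx.
apply: planeP; rewrite !coordE -hx -hy.
  transitivity (((a ^+ 2 + s ^+ 2 * b ^+ 2) * cx (T x) + a * b * cy (T x) * (1
    - s ^+ 2))); last by ring.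
  by rewrite s2 mul1r ab; ring.
transitivity (((b ^+ 2 + s ^+ 2 * a ^+ 2) * cy (T x) + a * b * cx (T x) * (1 -
  s ^+ 2))); last by ring.
by rewrite s2 mul1r (addrC (b ^+ 2)) ab; ring.
Qed.

Lemma isometry_inj (g : plane R -> plane R) : euclidean_isometry g -> injective g.
Proof.
move=> isog x y gxy; apply/eqP; rewrite -subr_eq0 -enorm_eq0 -distE -isog gxy.
by rewrite distE subrr enorm0.
Qed.

Lemma isometry_surj (g : plane R -> plane R) y : euclidean_isometry g ->
  exists x, g x = y.
Proof.
move=> /isometry_lin[a [b [s [ab s2 gE]]]].
have [x xE] := lin_surj (y - g 0) ab s2.
by exists x; rewrite gE xE subrK.
Qed.

Lemma isometry_interior (g : plane R -> plane R) (A B : set (plane R)) x :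
  euclidean_isometry g -> g @` A `<=` B -> interior A x -> interior B (g x).
Proof.
move=> isog gA /interior_enormP[e e0 eA]; apply/interior_enormP; exists e => // q.
have [y <-] := isometry_surj q isog; rewrite -distE isog => yx.
by apply: gA; exists y => //; exact: eA.
Qed.

End Isometries.

(** * Runs of orbits *)

Section Runs.
Variable R : realType.
Variables (K D1 D2 : set (plane R)) (f1 k1 f2 k2 g : plane R -> plane R).

Record two_tiles : Prop := TwoTiles {
  tt_dp1 : disc_param D1 f1 k1;
  tt_dp2 : disc_param D2 f2 k2;
  tt_cover : D1 `|` D2 = K;
  tt_disj : forall x, interior D1 x -> ~ interior D2 x;
  tt_iso : euclidean_isometry g;
  tt_image : g @` D1 = D2 }.

Hypothesis tt : two_tiles.

(** A tile is the closure of its interior, so a ball in [A] around a point of [B] would meet the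
    interior of [B]. *)
Lemma disc_interior_disjoint (A B : set (plane R)) (f k : plane R -> plane R) x :
  disc_param B f k -> (forall x, interior A x -> ~ interior B x) ->
  interior A x -> ~ B x.
Proof.
move=> dp dis iA Bx; have /interior_enormP[e e0 eA] : interior (interior A) x.
  exact: nbhs_interior.
have [q iB qx] := disc_param_closure_interior dp Bx e0.
by apply: dis iB; exact: eA.
Qed.

Lemma tt_disj1 x : interior D1 x -> ~ D2 x.
Proof. exact: disc_interior_disjoint (tt_dp2 tt) (tt_disj tt). Qed.

Lemma tt_disj2 x : interior D2 x -> ~ D1 x.
Proof.
apply: disc_interior_disjoint (tt_dp1 tt) _ => y i2 i1.
exact: (tt_disj tt i1 i2).
Qed.

Lemma tt_sub1 x : D1 x -> K x.
Proof. by rewrite -(tt_cover tt); left. Qed.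

Lemma tt_sub2 x : D2 x -> K x.
Proof. by rewrite -(tt_cover tt); right. Qed.

Lemma tt_g x : D2 (g x) <-> D1 x.
Proof.
rewrite -(tt_image tt); split=> [[y Dy /(isometry_inj (tt_iso tt)) <-//]|].
by exists x.
Qed.

Lemma tt_closed1 : closed D1.
Proof.
apply: compact_closed; first exact: norm_hausdorff.
exact: disc_param_compact (tt_dp1 tt).
Qed.

Lemma tt_closed2 : closed D2.
Proof.
apply: compact_closed; first exact: norm_hausdorff.
exact: disc_param_compact (tt_dp2 tt).
Qed.

Lemma interior_cover (A B : set (plane R)) x : closed B ->
  interior (A `|` B) x -> ~ B x -> interior A x.
Proof.
move=> clB iAB nB; have : interior (~` B) x.
  by apply: open_nbhs_nbhs; split=> //; exact: closed_openC.
move: iAB; rewrite /interior => h1 h2.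
by apply: filterS2 h1 h2 => y [].
Qed.

Lemma tt_int1 x : interior K x -> ~ D2 x -> interior D1 x.
Proof. by rewrite -(tt_cover tt); apply: interior_cover; exact: tt_closed2. Qed.

Lemma tt_g1 x : interior D1 x -> interior D2 (g x).
Proof. by apply: isometry_interior (tt_iso tt) _; rewrite (tt_image tt). Qed.

(** The return step of the alternation: if [g x] were in [D2], then [x] would be in [D1]. *)
Lemma tt_g2 x : interior D2 x -> interior K (g x) -> interior D1 (g x).
Proof.
by move=> i2 iK; apply: tt_int1 => // /tt_g; exact: tt_disj2.
Qed.

(* Along an orbit inside [K] the two tiles alternate; entering [K] it must
   start in [D1], and leaving [K] it must end in [D2]. *)
Lemma run_even x n : ~ K x ->
  (forall i, (0 < i <= n)%N -> interior K (iter i g x)) ->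
  ~ K (iter n.+1 g x) -> ~~ odd n.
Proof.
move=> nKx iK nKn.
have alt i : (0 < i <= n)%N ->
    if odd i then interior D1 (iter i g x) else interior D2 (iter i g x).
  elim: i => // i IH /andP[_ iN]; have [i0|i0] := posnP i.
    (* The starting point is outside [K], hence outside [D1], so its image is not in [D2]. *)
    subst i; apply: tt_int1; first exact: iK.
    by move/tt_g/tt_sub1.
  have := IH ltac:(by rewrite i0 ltnW); rewrite [odd i.+1]/=.
  case: (odd i) => /= h; first exact: tt_g1.
  by apply: tt_g2 => //; exact: (iK i.+1).
apply/negP => on; have n0 : (0 < n)%N by case: n on {iK nKn alt}.
have := alt n ltac:(by rewrite n0 leqnn); rewrite on => /tt_g1 /interior_subset.
by move/tt_sub2.
Qed.

(** A point of [D1] cannot leave [K] under [g]; so [x] lies in [D2] and comes from [D1]. *)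
Lemma run_single x : K x -> ~ K (g x) -> exists2 y, K y & g y = x.
Proof.
rewrite -{1}(tt_cover tt) => -[D1x []|D2x _]; first by apply/tt_sub2/tt_g.
by move: D2x; rewrite -(tt_image tt) => -[y /tt_sub1 Ky <-]; exists y.
Qed.

End Runs.

(** * Translations and glide reflections *)

Section GlideReflections.
Variable R : realType.
Implicit Types (x y z p q v w : plane R) (K : set (plane R)).

(** Here [n.+1] is the ceiling of [L], so [n] counts the positive integers strictly below [L], also
    when [L] is an integer. *)
Lemma nat_bracket (L : R) : 0 < L -> exists n : nat, n%:R < L <= n.+1%:R.
Proof.
move=> L0; have exL : exists k : nat, L <= k%:R.
  exists (Num.truncn L).+1; exact/ltW/truncnS_gt.
case: (ex_minnP exL) => -[|n] Ln minn; first by move: Ln; rewrite leNgt L0.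
exists n; rewrite Ln andbT ltNge; apply/negP => /minn; by rewrite ltnn.
Qed.

Lemma interior_uniform K (c : nat -> plane R) n :
  (forall i, (0 < i <= n)%N -> interior K (c i)) ->
  exists2 e : R, 0 < e & forall i, (0 < i <= n)%N ->
    forall q, enorm (q - c i) < e -> interior K q.
Proof.
elim: n => [|n IH] iK.
  by exists 1 => // i; rewrite leqn0 => /andP[/lt0n_neq0/negPf ->].
have [|e e0 eP] := IH; first by move=> i /andP[i0 iN]; apply: iK; rewrite i0 ltnW.
have /nbhs_interior/nbhs_enormP[d d0 dP] := iK n.+1 ltac:(by rewrite ltnSn).
exists (Num.min e d) => [|i /andP[i0]]; first by rewrite lt_min e0.
rewrite leq_eqVlt ltnS => /predU1P[->|iN] q; rewrite lt_min => /andP[qe qd].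
  exact: dP.
by apply: (eP i); rewrite ?i0.
Qed.

(** A boundary point exists on the way to a point outside the bounded set [K]. By convexity with the
    interior point [z], all points before it are interior, and a point of [K] beyond it would make
    it interior too. *)
Lemma chord_end K z v : convex_disc K -> interior K z -> v != 0 ->
  exists2 b : R, 0 < b & [/\ boundary K (z + b *: v),
    forall t : R, 0 <= t < b -> interior K (z + t *: v) &
    forall t : R, b < t -> ~ K (z + t *: v)].
Proof.
move=> dK iz v0; have clK := disc_closed dK.
have nv0 : 0 < `|v| by rewrite normr_gt0.
have [T T0 nT] : exists2 T : R, 0 < T & ~ K (z + T *: v).
  have [cK _ _] := dK; have [M [_ MK]] := compact_bounded cK.
  pose B := `|M| + 1 + `|z|.
  have B0 : 0 < B by rewrite /B; have := normr_ge0 M; have := normr_ge0 z; lra.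
  exists (2 * B / `|v|); first by rewrite divr_gt0// mulr_gt0.
  have M1 : M < `|M| + 1 by rewrite (le_lt_trans (ler_norm _))// ltrDl.
  move=> /(MK _ M1) /=; apply/negP; rewrite -ltNge.
  have := lerB_normD ((2 * B / `|v|) *: v) z.
  rewrite normrZ gtr0_norm ?divr_gt0 ?mulr_gt0// divfK ?gt_eqF// (addrC _ z).
  by apply: lt_le_trans; rewrite /B; have := normr_ge0 M; have := normr_ge0 z; lra.
have [||| t /andP[t0 t1] bt] := @boundary_on_segment _ K z (z + T *: v).
- exact: clK.
- exact: iz.
- by move/interior_subset.
have et : (1 - t) *: z + t *: (z + T *: v) = z + (t * T) *: v.
  by apply: planeP; rewrite !coordE; ring.
have b_ge0 : 0 <= t * T by rewrite mulr_ge0// ltW.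
rewrite {}et in bt; move: (t * T) b_ge0 bt => b b_ge0 bt; have [_ nib] := bt.
have b0 : 0 < b.
  rewrite lt_def b_ge0 andbT; apply/eqP => e0.
  by apply: nib; rewrite e0 scale0r addr0.
have Kb : K (z + b *: v).
  by move: bt => [+ _]; rewrite -(closure_id _).1.
exists b => //; split=> // s.
  move=> /andP[s0 sb].
  have -> : z + s *: v = (1 - (1 - s / b)) *: (z + b *: v) +
     (1 - s / b) *: z.
    by apply: planeP; rewrite !coordE; field; rewrite gt_eqF.
  apply: interior_conv => //; rewrite subr_gt0 ltr_pdivrMr// mul1r sb/=.
  by rewrite gerBl divr_ge0// ltW.
move=> bs Ks; apply: nib; have s0 := lt_trans b0 bs.
have -> : z + b *: v = (1 - (1 - b / s)) *: (z + s *: v) +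
     (1 - b / s) *: z.
  by apply: planeP; rewrite !coordE; field; rewrite gt_eqF.
apply: interior_conv => //; rewrite subr_gt0 ltr_pdivrMr// mul1r bs/=.
by rewrite gerBl divr_ge0// ltW.
Qed.

(** * Isometries whose linear part is an involution *)

Section InvolutiveLinearPart.
Variables (K D1 D2 : set (plane R)) (f1 k1 f2 k2 g S : plane R -> plane R).
Variable c : plane R.
Hypotheses (dK : convex_disc K) (stK : strictly_convex K) (smK : smooth K).
Hypothesis tt : two_tiles K D1 D2 f1 k1 f2 k2 g.
Hypothesis linS : forall (t : R) x y, S (t *: x + y) = t *: S x + S y.
Hypothesis normS : forall x, enorm (S x) = enorm x.
Hypothesis SK : forall x, S (S x) = x.
Hypothesis gE : forall x, g x = S x + c.

Let SD x y : S (x + y) = S x + S y.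
Proof. by rewrite -{1}[x]scale1r linS scale1r. Qed.
Let S0 : S 0 = 0.
Proof. by apply: (addrI (S 0)); rewrite -SD !addr0. Qed.
Let SZ (t : R) x : S (t *: x) = t *: S x.
Proof. by rewrite -[t *: x]addr0 linS S0 addr0. Qed.

Let gD x w : g (x + w) = g x + S w.
Proof. by rewrite !gE SD addrAC. Qed.

Let iterD n x w : iter n g (x + w) = iter n g x + iter n S w.
Proof. by elim: n => //= n ->; exact: gD. Qed.

Let iterS n w : enorm (iter n S w) = enorm w.
Proof. by elim: n => //= n <-; exact: normS. Qed.

Let iterS2 n w : ~~ odd n -> iter n S w = w.
Proof.
move=> en; have [m ->] : exists m, n = m.*2.
  by exists n./2; rewrite -[LHS]odd_double_half (negPf en).
by elim: m {n en} => // m IH; rewrite doubleS /= IH SK.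
Qed.

(** The vector [S c + c] is the translation [g \o g]. If it is nonzero, [g] translates an invariant
    line by half of it, and orbits on or near the chord of [K] on that line have runs of both
    parities. *)
Lemma no_glide : S c + c = 0.
Proof.
apply/eqP; apply: contraT => nz; exfalso.
pose v := 2^-1 *: (S c + c).
have v0 : v != 0 by rewrite scaler_eq0 invr_eq0 pnatr_eq0.
have Sv : S v = v by rewrite SZ SD SK addrC.
have iz : interior D1 (f1 0) by apply: (disc_param_interior (tt_dp1 tt));
  rewrite enorm0.
(* The midpoint of a point and its image lies on the invariant line; here it is interior to [K] by
   convexity. *)
pose z := (1 - 2^-1) *: f1 0 + 2^-1 *: g (f1 0).
have izK : interior K z.
  apply: interior_conv => //.
  - by apply: (tt_sub1 tt); exact: interior_subset.
  - have := tt_g1 tt iz; apply: interiorS; exact: (tt_sub2 tt).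
  - by lra.
have gv (t : R) : g (z + t *: v) = z + (t + 1) *: v.
  rewrite gD SZ Sv gE /z SD !SZ !gE SD SK /v.
  by apply: planeP; rewrite !coordE; field.
have gvn n (t : R) : iter n g (z + t *: v) = z + (t + n%:R) *: v.
  elim: n => [|n IH]; first by rewrite addr0.
  by rewrite /= IH gv -natr1 addrA.
clearbody z v.
have [b b0 [bb ib nb]] := chord_end dK izK v0.
have [a a0 [ba ia na]] := chord_end dK izK (v := - v) ltac:(by rewrite oppr_eq0).
have iK (t : R) : - a < t < b -> interior K (z + t *: v).
  move=> /andP[ta tb]; have [t0|t0] := leP 0 t; first by apply: ib; rewrite t0.
  rewrite -[t]opprK scaleNr -scalerN; apply: ia; lra.
have nK (t : R) : t < - a \/ b < t -> ~ K (z + t *: v).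
  move=> [ta|]; last exact: nb.
  rewrite -[t]opprK scaleNr -scalerN; apply: na; lra.
rewrite scalerN -scaleNr in ba.
have [n /andP[nL Ln]] := nat_bracket (addr_gt0 a0 b0).
(* A start slightly less than one step outside the chord gives the [n.+1] positions [- a + d + i]
   with [i] from 0 to [n], all inside; hence [n.+1] is even. *)
have on : odd n.
  pose d := Num.min 1 (a + b - n%:R) / 2.
  have m0 : 0 < Num.min 1 (a + b - n%:R) by rewrite lt_min ltr01 subr_gt0.
  have m1 : Num.min 1 (a + b - n%:R) <= 1 by rewrite ge_min lexx.
  have m2 : Num.min 1 (a + b - n%:R) <= a + b - n%:R by rewrite ge_min lexx orbT.
  have [d0 d1 d2] : [/\ 0 < d, d < 1 & d + n%:R < a + b].
    by rewrite /d; split; lra.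
  have := @run_even _ _ _ _ _ _ _ _ _ tt (z + (- a - 1 + d) *: v) n.+1.
  rewrite /= negbK; apply.
  - by apply: nK; left; lra.
  - move=> [//|i] /= iN; rewrite -[g _]/(iter i.+1 g _) gvn; apply: iK.
    have : i%:R <= n%:R :> R by rewrite ler_nat.
    by rewrite -natr1; have := ler0n R i; lra.
  - rewrite -[g _]/(iter n.+2 g _) gvn; apply: nK; right.
    by move: Ln; rewrite -!natr1; lra.
(* The second run starts at the end [- a] of the chord and has [n] interior points. It is displaced
   by a small [w] to move both of its outer points out of [K]; since [n.+1] is even, the last point
   is displaced by [w] again. *)
have [e e0 eP] := @interior_uniform K (fun i => z + (- a + i%:R) *: v) n
  ltac:(move=> i /andP[i0 iN]; apply: iK; move: iN; rewrite -(ler_nat R);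
    move: i0; rewrite -(ltr_nat R); lra).
suff [w we [w1 w2]] : exists2 w, enorm w < e &
    ~ K (z + - a *: v + w) /\ ~ K (z + (- a + n.+1%:R) *: v + w).
  have := @run_even _ _ _ _ _ _ _ _ _ tt (z + - a *: v + w) n w1.
  rewrite on => h; apply/negP: isT; apply: h.
    move=> i iN; rewrite iterD gvn; apply: (eP i iN).
    by rewrite addrC addKr iterS.
  by rewrite iterD gvn iterS2 //= on.
(* If the last point is already beyond the chord, a small slide backwards along the line
   suffices. *)
have [Lt|Lt] := ltP (a + b) n.+1%:R.
  have v0' : 0 < enorm v by rewrite enorm_gt0.
  pose s := Num.min (e / enorm v) (n.+1%:R - (a + b)) / 2.
  have m0 : 0 < Num.min (e / enorm v) (n.+1%:R - (a + b)).
    by rewrite lt_min divr_gt0//= subr_gt0.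
  have m1 : Num.min (e / enorm v) (n.+1%:R - (a + b)) <= e / enorm v.
    by rewrite ge_min lexx.
  have m2 : Num.min (e / enorm v) (n.+1%:R - (a + b)) <= n.+1%:R - (a + b).
    by rewrite ge_min lexx orbT.
  have [s0 s1 s2] : [/\ 0 < s, s < e / enorm v & s < n.+1%:R - (a + b)].
    by rewrite /s; split; lra.
  exists (- s *: v).
    by rewrite scaleNr enormN enormZ gtr0_norm// -ltr_pdivlMr.
  rewrite -!addrA -!scalerDl; split; apply: nK; [left|right]; lra.
(* Now both outer points are ends of the chord. A vector [w] along the tangent at the first end
   leaves [K] there with either sign, and at the second end [w] and [- w] cannot both stay in [K],
   by strict support. *)
have {Ln} Ln : n.+1%:R = a + b by apply/eqP; rewrite eq_le Ln Lt.
rewrite Ln addKr.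
have [m m0 [mK _]] := smooth_support dK stK smK ba.
have [l l0 [lK _]] := smooth_support dK stK smK bb.
have nm0 : 0 < enorm m by rewrite enorm_gt0.
pose w := (e / (2 * enorm m)) *: vec (- cy m) (cx m).
have sm0 : 0 < e / (2 * enorm m) by rewrite divr_gt0// mulr_gt0.
have wm : dot w m = 0 by rewrite /w dotZl dotE !coordE; ring.
have we : enorm w < e.
  rewrite /w enormZ gtr0_norm//.
  have -> : enorm (vec (- cy m) (cx m)) = enorm m.
    by rewrite /enorm !dotE !coordE mulrNN addrC.
  have -> : e / (2 * enorm m) * enorm m = e / 2 by field; rewrite gt_eqF.
  lra.
have w0 : w != 0.
  rewrite /w scaler_eq0 gt_eqF//= -dot_eq0 dotE !coordE mulrNN addrC -dotE.
  by rewrite dot_eq0.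
have addI x y : y != 0 -> x + y != x.
  by move=> y0; rewrite -subr_eq0 addrC addKr.
have out y : y != 0 -> dot y m = 0 -> ~ K (z + - a *: v + y).
  move=> y0 ym Ky; have := mK _ Ky (addI _ _ y0).
  by rewrite addrC addKr ym ltxx.
have [Kw|nKw] := pselect (K (z + b *: v + w)); last first.
  by exists w => //; split=> //; exact: out.
exists (- w); first by rewrite enormN.
split; first by apply: out; rewrite ?oppr_eq0// dotNl wm oppr0.
move=> Kw'; have := lK _ Kw (addI _ _ w0).
have nw0 : - w != 0 by rewrite oppr_eq0.
have := lK _ Kw' (addI _ _ nw0).
by rewrite !(addrC (z + _)) !addrK dotNl; lra.
Qed.

End InvolutiveLinearPart.
End GlideReflections.

(** * Rotations *)

Section Rotations.
Variable R : realType.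
Implicit Types (x y z p q v w o : plane R) (K : set (plane R)).

Lemma rotation_fixed_point (a b : R) w : b != 0 ->
  exists o, lin a b 1 o + w = o.
Proof.
(* The determinant of the identity minus the rotation, which is inverted explicitly. *)
move=> b0; pose d := (1 - a) ^+ 2 + b ^+ 2.
have d0 : d != 0.
  by rewrite gt_eqF// ltr_wpDl ?sqr_ge0// lt_def sqr_ge0 sqrf_eq0 b0.
exists (vec (((1 - a) * cx w - b * cy w) / d) ((b * cx w + (1 - a) * cy w) / d)).
by apply: planeP; rewrite !coordE; rewrite /d in d0 *; field.
Qed.

Lemma inner_uniform K p (d : nat -> plane R) n : convex_disc K -> K p ->
  (forall i, (0 < i <= n)%N -> inner K p (d i)) ->
  exists2 r : R, 0 < r & forall i, (0 < i <= n)%N -> interior K (p + r *: d i).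
Proof.
move=> dK Kp inn.
suff [r r0 rP] : exists2 r : R, 0 < r & forall i, (0 < i <= n)%N ->
    forall s, 0 < s <= r -> interior K (p + s *: d i).
  by exists r => // i iN; apply: rP; rewrite // r0 lexx.
elim: n inn => [|n IH] inn.
  by exists 1 => // i; rewrite leqn0 => /andP[/lt0n_neq0/negPf ->].
have [|r r0 rP] := IH; first by move=> i /andP[i0 iN]; apply: inn; rewrite i0 ltnW.
have [s s0 sP] := innerP dK Kp (inn n.+1 ltac:(by rewrite ltnSn)).
exists (Num.min r s) => [|i /andP[i0]]; first by rewrite lt_min r0.
rewrite leq_eqVlt ltnS => /predU1P[->|iN] t /andP[t0]; rewrite le_min => /andP[tr ts].
  by apply: sP; rewrite t0.
by apply: (rP i); rewrite ?i0 ?t0.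
Qed.

Lemma convex_comb_lt (x y c r : R) : x < r -> y < r -> 0 <= c <= 1 ->
  (1 - c) * x + c * y < r.
Proof.
move=> xr yr /andP[c0 c1]; have [->|cn0] := eqVneq c 0; first by lra.
have : 0 < c * (r - y) by rewrite mulr_gt0 ?subr_gt0// lt_def cn0.
have : 0 <= (1 - c) * (r - x) by rewrite mulr_ge0 ?subr_ge0// ltW.
lra.
Qed.

Lemma dot_lt1 (u s : plane R) : enorm u <= 1 -> enorm s = 1 -> u != s -> dot u s < 1.
Proof.
move=> u1 s1; rewrite -subr_eq0 -dot_gt0 => us.
have : dot u u <= 1.
  by rewrite -enorm_sqr expr_le1// enorm_ge0.
have : dot s s = 1 by rewrite -enorm_sqr s1 expr1n.
by move: us; rewrite !dotE !coordE; lra.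
Qed.

Section Tiles.
Variables (K D1 D2 : set (plane R)) (f k f2 k2 g : plane R -> plane R).
Variables (a b : R) (o : plane R).
Hypotheses (dK : convex_disc K) (stK : strictly_convex K) (smK : smooth K).
Hypothesis tt : two_tiles K D1 D2 f k f2 k2 g.
Hypotheses (ab1 : a ^+ 2 + b ^+ 2 = 1) (b0 : b != 0).
Hypothesis gE : forall w, g (o + w) = o + lin a b 1 w.

Let g_fix x : g x = x -> x = o.
Proof.
rewrite -(subrK o x) addrC; set w := x - o; rewrite gE => /addrI e.
suff -> : w = 0 by rewrite addr0.
apply/eqP; rewrite -dot_eq0; apply: contraT => nz; move: b0.
have : ((1 - a) ^+ 2 + b ^+ 2) * dot w w = 0.
  transitivity (dot (lin a b 1 w - w) (lin a b 1 w - w)).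
    by rewrite !dotE !coordE; ring.
  by rewrite e subrr dot0l.
move/eqP; rewrite mulf_eq0 (negPf nz) orbF paddr_eq0 ?sqr_ge0// !sqrf_eq0.
by move=> /andP[_ ->].
Qed.

Let go : g o = o.
Proof.
rewrite -{1}(addr0 o) gE (_ : lin _ _ _ _ = 0) ?addr0//.
by apply: planeP; rewrite !coordE; ring.
Qed.

Let g_dist x : enorm (g x - o) = enorm (x - o).
Proof. by rewrite -{1}go -!distE (tt_iso tt). Qed.

(** The point [q] of [K] nearest to [o] is unique. Either [g q] or, by [run_single], a preimage of
    [q] is in [K] at the same distance; so [q] is fixed and equals [o]. *)
Lemma rotation_center_in : K o.
Proof.
have [cK _ [z iz]] := dK.
have [||| q qK qmin] := @EVT_max_rV R 2 (fun x => - enorm (x - o)) K.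
- by exists z; exact: interior_subset.
- exact: cK.
- apply: continuous_subspaceT => x.
  apply: (@continuousN R R^o _ (fun x => enorm (x - o))); apply: continuous_enorm.
  by apply: continuousB; [exact: cvg_id|exact: cst_continuous].
rewrite inE in qK.
have {}qmin y : K y -> enorm (q - o) <= enorm (y - o).
  by move=> Ky; rewrite -lerN2 qmin// inE.
have uniq y : K y -> enorm (y - o) = enorm (q - o) -> y = q.
  move=> Ky yq; apply/eqP; rewrite -subr_eq0 -dot_eq0 eq_le dot_ge0 andbT.
  (* The midpoint of two distinct nearest points would be nearer. *)
  have := qmin _ (disc_conv dK qK Ky (t := 2^-1) ltac:(lra)).
  rewrite -(@ler_pXn2r _ 2) ?nnegrE ?enorm_ge0// enorm_sqr.
  have : dot (y - o) (y - o) = dot (q - o) (q - o) by rewrite -!enorm_sqr yq.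
  by rewrite enorm_sqr !dotE !coordE; nra.
have [Kgq|nKgq] := pselect (K (g q)).
  by rewrite -(g_fix (uniq _ Kgq (g_dist q))).
have [y Ky yq] := run_single tt qK nKgq.
have e : y = q by apply: uniq => //; rewrite -g_dist yq.
by rewrite -(g_fix (etrans (congr1 g (esym e)) yq)).
Qed.

(** In polar coordinates at [o] with the inner normal at angle [pi / 2], angles strictly between 0
    and [pi] enter [K], those with nonpositive sine miss it, and [g] adds [th]. Starting angles [0]
    and [de - th] give runs of lengths [m] and [m.+1]. *)
Lemma rotation_center_interior : interior K o.
Proof.
apply: contrapT => nio.
have bo : boundary K o by split=> //; apply/subset_closure/rotation_center_in.
have Ko := rotation_center_in.
have [n n0 [supp inn]] := smooth_support dK stK smK bo.
have a1 : -1 <= a <= 1.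
  rewrite -ler_norml -(@ler_pXn2r _ 2) ?nnegrE//.
  by rewrite expr1n real_normK ?num_real// -ab1 lerDl sqr_ge0.
pose th := acos a.
have cth : cos th = a by rewrite acosK// in_itv/=.
have sth : sin th = `|b|.
  by rewrite /th sin_acos// -sqrtr_sqr; congr Num.sqrt; rewrite -ab1 addrC addKr.
have th0 : 0 < th.
  rewrite lt_def acos_ge0// andbT; apply/eqP => e.
  by move: sth; rewrite e sin0 => /esym/eqP; rewrite normr_eq0 (negPf b0).
have thpi : th < pi.
  rewrite lt_neqAle acos_lepi// andbT; apply/eqP => e.
  by move: sth; rewrite e sinpi => /esym/eqP; rewrite normr_eq0 (negPf b0).
(* The sign of [b] orients the frame so that [g] turns by the positive angle [th] in either case. *)
pose v := - Num.sg b *: vec (- cy n) (cx n).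
have sgb : Num.sg b ^+ 2 = 1 by rewrite sqr_sg b0.
have bE : b = Num.sg b * `|b| by rewrite -numEsg.
pose d (phi : R) := cos phi *: v + sin phi *: n.
have nn0 : 0 < dot n n by rewrite dot_gt0.
have vn : dot v n = 0 by rewrite /v dotZl dotE !coordE; ring.
have vv : dot v v = dot n n.
  transitivity (Num.sg b ^+ 2 * dot n n); last by rewrite sgb mul1r.
  by rewrite /v !dotE !coordE; ring.
have gd (r phi : R) : g (o + r *: d phi) = o + r *: d (phi + th).
  rewrite gE; congr (_ + _); rewrite /d /v cosD sinD cth sth.
  move: sgb bE; set sb := Num.sg b; set nb := `|b| => sgb bE.
  have sbb : sb * b = nb by rewrite bE mulrA -expr2 sgb mul1r.
  apply: planeP; rewrite !coordE -sbb.
    transitivity (r * (a * (cos phi * (- sb * - cy n) + sin phi * cx n)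
      - b * (cos phi * (- sb * cx n) + sin phi * cy n))); first by ring.
    transitivity (r * (a * (cos phi * (- sb * - cy n) + sin phi * cx n)
      - b * (cos phi * (- sb * cx n) + sb ^+ 2 * sin phi * cy n))).
      by rewrite sgb mul1r.
    by ring.
  transitivity (r * (a * (cos phi * (- sb * cx n) + sin phi * cy n)
      + b * (cos phi * (- sb * - cy n) + sin phi * cx n))); first by ring.
  transitivity (r * (a * (cos phi * (- sb * cx n) + sin phi * cy n)
      + b * (cos phi * (- sb * - cy n) + sb ^+ 2 * sin phi * cx n))).
    by rewrite sgb mul1r.
  by ring.
clearbody v.
have gdn i (r phi : R) : iter i g (o + r *: d phi) = o + r *: d (phi + i%:R * th).
  elim: i => [|i IH]; first by rewrite mul0r addr0.
  by rewrite /= IH gd -natr1 mulrDl mul1r addrA.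
have dn phi : dot (d phi) n = sin phi * dot n n.
  by rewrite /d dotDl !dotZl vn mulr0 add0r.
have d0 phi : d phi != 0.
  rewrite -dot_eq0 (_ : dot _ _ = dot n n) ?gt_eqF//.
  transitivity ((cos phi ^+ 2 + sin phi ^+ 2) * dot n n).
    by rewrite /d !dotE_lin (dotC n v) vn vv; ring.
  by rewrite cos2Dsin2 mul1r.
have out r phi : 0 < r -> sin phi <= 0 -> ~ K (o + r *: d phi).
  move=> r0 sp Kd; have : o + r *: d phi != o.
    by rewrite -subr_eq0 addrC addKr scaler_eq0 negb_or gt_eqF// d0.
  move/(supp _ Kd); rewrite addrC addKr dotZl dn ltNge => /negP; apply.
  by rewrite pmulr_rle0// mulr_le0_ge0// ltW.
have sin_out phi : pi <= phi <= 2 * pi -> sin phi <= 0.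
  move=> /andP[p1 p2]; rewrite -(subrK pi phi) sinDpi oppr_le0 sin_ge0_pi//; lra.
have [m /andP[m1 m2]] := nat_bracket (divr_gt0 (pi_gt0 R) th0).
rewrite ltr_pdivlMr// in m1; rewrite ler_pdivrMr// -natr1 mulrDl mul1r in m2.
have inside (phi : R) l : (forall i, (0 < i <= l)%N -> 0 < phi + i%:R * th < pi) ->
    exists2 r : R, 0 < r & forall i, (0 < i <= l)%N ->
      interior K (iter i g (o + r *: d phi)).
  move=> H; have [i /H /sin_gt0_pi si|r r0 rP] :=
    @inner_uniform K o (fun i => d (phi + i%:R * th)) l dK Ko.
    by apply: inn; rewrite dn mulr_gt0.
  by exists r => // i iN; rewrite gdn; exact: rP.
have lei i : (i <= m)%N -> i%:R * th <= m%:R * th.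
  by move=> im; rewrite ler_pM2r// ler_nat.
have even_m : ~~ odd m.
  have [i /andP[i0 iN]|r r0 rP] := inside 0 m.
    rewrite add0r mulr_gt0 ?ltr0n//=; exact: le_lt_trans (lei _ iN) m1.
  apply: (run_even tt _ rP).
    by apply: out => //; rewrite sin0.
  rewrite gdn; apply: out => //; apply: sin_out.
  by rewrite -natr1; lra.
(* Small enough that [de - th] is still outside and [de + m%:R * th] is still inside. *)
pose de := Num.min th (pi - m%:R * th) / 2.
have h0 : 0 < Num.min th (pi - m%:R * th) by rewrite lt_min th0 subr_gt0.
have h1 : Num.min th (pi - m%:R * th) <= th by rewrite ge_min lexx.
have h2 : Num.min th (pi - m%:R * th) <= pi - m%:R * th by rewrite ge_min lexx orbT.
have [de0 deth dem] : [/\ 0 < de, de < th & de + m%:R * th < pi].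
  by rewrite /de; split; lra.
suff : ~~ odd m.+1 by rewrite /= even_m.
have [[//|i] /andP[_ iN]|r r0 rP] := inside (de - th) m.+1.
  have := lei i iN; have : 0 <= i%:R * th by rewrite mulr_ge0// ltW.
  by rewrite -natr1; lra.
apply: (run_even tt _ rP).
  apply: out => //; rewrite -oppr_ge0 -sinN; apply: sin_ge0_pi; lra.
rewrite gdn; apply: out => //; apply: sin_out.
by rewrite -!natr1; lra.
Qed.

Let g2 (x : plane R) := g (g x).

Let g2_dist (x : plane R) : enorm (g2 x - o) = enorm (x - o).
Proof. by rewrite /g2 !g_dist. Qed.

Let continuous_g2 : continuous g2.
Proof.
move=> x A /nbhs_enormP[e e0 eA]; apply/nbhs_enormP; exists e => // q qx.
by apply: eA; rewrite -distE /g2 !(tt_iso tt).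
Qed.

(** For interior points of [D1] near [o] this is two steps of the alternation, since [g] preserves
    the distance to [o]; the other points of [D1] are limits of these. *)
Lemma g2_tile (e : R) x : (forall q, enorm (q - o) < e -> interior K q) ->
  D1 x -> enorm (x - o) < e -> D1 (g2 x).
Proof.
move=> eK D1x xe; apply: (tt_closed1 tt) => B /continuous_g2/nbhs_enormP[d d0 dB].
have m0 : 0 < Num.min d (e - enorm (x - o)) by rewrite lt_min d0 subr_gt0.
have [q iq] := disc_param_closure_interior (tt_dp1 tt) D1x m0.
rewrite lt_min => /andP[qd qe]; exists (g2 q); split; last exact: dB.
have {}qe : enorm (q - o) < e.
  by have := ler_enormD (q - x) (x - o); rewrite addrA subrK; lra.
apply: interior_subset; apply: (tt_g2 tt); first exact: (tt_g1 tt).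
by apply: eK; rewrite g2_dist.
Qed.

(* [P] joins a point [x] of [D1] near [o] to [g (g x)] inside [D1] minus [o]; the
   angle changes by the same amount [c] along all the paths [Pj j]. *)
Lemma no_inner_rotation : ~ interior K o.
Proof.
move=> /nbhs_interior/nbhs_enormP[e e0 eK].
(* Being fixed, [o] belongs to both tiles, so it is interior to neither and its parameter [s] lies
   on the unit circle. *)
have D1o : D1 o.
  have : K o by apply: interior_subset; apply: eK; rewrite subrr enorm0.
  rewrite -(tt_cover tt) => -[//|D2o]; apply/(tt_g tt); by rewrite go.
have nio : ~ interior D1 o.
  by move=> io; apply: (tt_disj1 tt io); rewrite -go; apply/(tt_g tt).
have dp := tt_dp1 tt; pose s := k o.
have s1 : enorm s = 1 by exact: (disc_param_boundary dp D1o nio).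
have fs : f s = o by rewrite /s (dp_kK dp).
have near_s (d : R) : 0 < d -> exists2 eta : R, 0 < eta &
    forall u, enorm (u - s) < eta -> enorm (f u - o) < d.
  move=> d0; apply/nbhs_enormP; have : nbhs (f s) [set y | enorm (y - o) < d].
    by apply/nbhs_enormP; exists d; rewrite // fs.
  exact: (dp_cont dp).
(* The radii [eta] and [rho] make the segment joining the parameters of [x] and [g2 x] stay so close
   to [s] that its image stays within [e] of [o]. *)
have [eta eta0 etaP] := near_s e e0.
have [rho rho0 rhoP] : exists2 rho : R, 0 < rho & forall y, D1 y ->
    enorm (y - o) < rho -> enorm (k y - s) < eta.
  have /subspace_continuousP/(_ o D1o) := dp_kcont dp.
  have /[swap]/[apply] : nbhs (k o) [set u | enorm (u - s) < eta].
    by apply/nbhs_enormP; exists eta.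
  rewrite /= nbhs_simpl /within /= => /nbhs_enormP[r r0 rP].
  by exists r => // y Dy yr; exact: rP.
have [x ix xlt] : exists2 x, interior D1 x & enorm (x - o) < Num.min rho e.
  by apply: (disc_param_closure_interior dp D1o); rewrite lt_min rho0.
have D1x := interior_subset ix.
have xo : x != o by apply/eqP => xo; apply: nio; rewrite -xo.
have [xrho xe] : enorm (x - o) < rho /\ enorm (x - o) < e.
  by apply/andP; rewrite -lt_min.
have D1x' : D1 (g2 x) by exact: (g2_tile eK D1x xe).
pose clamp (t : R) : R := Num.max 0 (Num.min 1 t).
have clampI t : 0 <= clamp t <= 1.
  by rewrite /clamp le_max lexx ge_max ler01 ge_min lexx.
have clamp0 : clamp 0 = 0 by rewrite /clamp (min_idPr ler01); apply/max_idPl.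
have clamp1 : clamp 1 = 1 by rewrite /clamp minxx; apply/max_idPr/ler01.
have cclamp : continuous clamp.
  move=> t; apply: (@continuous_max R R (fun=> 0) (fun t => Num.min 1 t)).
    exact: cst_continuous.
  by apply: (@continuous_min R R (fun=> 1) id); [exact: cst_continuous|exact: cvg_id].
pose sg (t : R) : plane R := (1 - clamp t) *: k x + clamp t *: k (g2 x).
have csg : continuous sg.
  move=> t; apply: (@continuousD R (plane R) R^o (fun t : R^o => (1 - clamp t) *: k x)
    (fun t : R^o => clamp t *: k (g2 x))).
    apply: (@continuousZr_tmp R _ R^o (fun t : R^o => 1 - clamp t)).
    by apply: (@continuousB R R^o R^o (fun=> 1));
      [exact: cst_continuous|exact: cclamp].
  by apply: (@continuousZr_tmp R _ R^o clamp); exact: cclamp.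
have sg1 t : enorm (sg t) <= 1.
  have /andP[c0 c1] := clampI t; apply: (le_trans (ler_enormD _ _)).
  rewrite !enormZ !ger0_norm ?subr_ge0//.
  have := dp_kin dp D1x; have := dp_kin dp D1x'; nra.
have sgs t : enorm (sg t - s) < eta.
  have /andP[c0 c1] := clampI t; have h1 := rhoP _ D1x xrho.
  have h2 : enorm (k (g2 x) - s) < eta by apply: rhoP; rewrite ?g2_dist.
  have -> : sg t - s = (1 - clamp t) *: (k x - s) + clamp t *: (k (g2 x) - s).
    by apply: planeP; rewrite !coordE; ring.
  apply: (le_lt_trans (ler_enormD _ _)).
  by rewrite !enormZ !ger0_norm ?subr_ge0//; apply: convex_comb_lt => //; rewrite c0.
have ks y : D1 y -> y != o -> dot (k y) s < 1.
  move=> Dy yo; apply: dot_lt1 => //; first exact: (dp_kin dp).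
  by apply: contra_neq yo => kys; rewrite -(dp_kK dp Dy) kys.
have x'o : g2 x != o.
  by rewrite -subr_eq0 -enorm_eq0 g2_dist enorm_eq0 subr_eq0.
(* The parameter path avoids [s]: its two ends lie in the open half-plane [dot u s < 1]. *)
have sgdot t : dot (sg t) s < 1.
  rewrite dotDl !dotZl; apply: convex_comb_lt => //; exact: ks.
pose P := f \o sg.
have cP : continuous P.
  by move=> t; apply: continuous_comp; [exact: csg|exact: (dp_cont dp)].
have D1P t : D1 (P t) by exact: (dp_in dp).
have Pe t : enorm (P t - o) < e by exact: etaP.
have P0 : P 0 = x by rewrite /P /= /sg clamp0 subr0 scale1r scale0r addr0 (dp_kK dp).
have P1 : P 1 = g2 x by rewrite /P /= /sg clamp1 subrr scale1r scale0r add0r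
  (dp_kK dp).
have Po t : P t != o.
  apply/eqP => Pt; have : sg t = s by rewrite /s -Pt /P /= (dp_fK dp).
  move=> e1; have := sgdot t; rewrite e1 -enorm_sqr s1 expr1n ltxx//.
(* The least distance of the path from [o]; all its images under iterates of [g2] keep it. *)
have [r0 r00 r0P] : exists2 r0 : R, 0 < r0 & forall t, 0 <= t <= 1 -> r0 <=
  enorm (P t - o).
  have [||t0 _ h] := @EVT_min R (fun t => enorm (P t - o)) 0 1; first exact: ler01.
    apply: continuous_subspaceT => t.
    apply: (@continuous_enorm R R t (fun t => P t - o)).
    by apply: continuousB; [exact: cP|exact: cst_continuous].
  by exists (enorm (P t0 - o)) => [|t tI];
    [rewrite enorm_gt0 subr_eq0 Po|apply: h; rewrite in_itv].
have [d d0 dP] := near_s r0 r00.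
have d2 : 0 < d ^+ 2 / 2 by rewrite divr_gt0// exprn_gt0.
pose dd := Num.min (d ^+ 2 / 2) 1.
have [dd0 ddd dd1] : [/\ 0 < dd, dd <= d ^+ 2 / 2 & dd <= 1].
  by rewrite lt_min d2 ltr01 !ge_min !lexx orbT.
(* The unit disc without a cap at [s]. It is star-shaped at the origin because [dd <= 1], and it
   contains the parameters of all points of [D1] at distance at least [r0] from [o], because the
   squared distance from [u] to [s] is at most [2 * (1 - dot u s)]. *)
pose A := [set u | enorm u <= 1 /\ dd <= 1 - dot u s].
have kA y : D1 y -> r0 <= enorm (y - o) -> A (k y).
  move=> Dy ry; have ky1 := dp_kin dp Dy; split=> //.
  have dk : d <= enorm (k y - s).
    rewrite leNgt; apply/negP => /dP; rewrite (dp_kK dp Dy) ltNge => /negP.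
    by apply.
  have : d ^+ 2 <= enorm (k y - s) ^+ 2 by rewrite ler_pXn2r// ?nnegrE
    ?enorm_ge0// ltW.
  have : enorm (k y) ^+ 2 <= 1 by rewrite expr_le1// enorm_ge0.
  have : enorm s ^+ 2 = 1 by rewrite s1 expr1n.
  by rewrite !enorm_sqr !dotE !coordE; lra.
have cA : compact A.
  apply: bounded_closed_compact.
    exists 1; split=> // M M1 u [/= u1 _].
    by rewrite (le_trans (normE_le _))// (le_trans u1)// ltW.
  apply: closedI.
    apply: (@closed_comp _ _ (fun u : plane R => enorm u) [set t | t <= 1]) =>
      [u _|]; last exact: closed_le.
    by apply: continuous_enorm; exact: cvg_id.
  apply: (@closed_comp _ _ (fun u => 1 - dot u s) [set t | dd <= t]) => [u _|].
    apply: (@continuousB R R^o _ (fun=> 1) (fun u => dot u s));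
      first exact: cst_continuous.
    by apply: continuous_dot; [exact: cvg_id|exact: cst_continuous].
  exact: closed_ge.
have cfo : continuous (fun u => f u - o).
  by move=> u; apply: continuousB; [exact: (dp_cont dp)|exact: cst_continuous].
have [|||||al alP] := @angle_lift R (plane R) (fun u => cx (f u - o)) (fun u =>
  cy (f u - o)) A.
- by move=> u; have [] := continuous_coord (@cfo u).
- by move=> u; have [] := continuous_coord (@cfo u).
- exact: cA.
- move=> u t [u1 us] /andP[t0 t1]; split.
    by rewrite enormZ ger0_norm//; have := enorm_ge0 u; nra.
  rewrite dotZl; have [us0|us0] := leP (dot u s) 0; last by nra.
  have : 0 <= t * - dot u s by rewrite mulr_ge0// oppr_ge0.
  by lra.
- move=> u [u1 us]; rewrite -negb_and; apply/negP => /andP[/eqP ex /eqP ey].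
  have fuo : f u = o.
    by apply/eqP; rewrite -subr_eq0; apply/eqP/planeP; rewrite ?ex ?ey coordE.
  have us' : u = s by rewrite /s -fuo (dp_fK dp).
  by move: us; rewrite us' -enorm_sqr s1 expr1n subrr leNgt dd0.
pose Pj j t := iter j g2 (P t).
have Pj_dist j t : enorm (Pj j t - o) = enorm (P t - o).
  by rewrite /Pj; elim: j => //= j <-; exact: g2_dist.
have D1Pj j t : D1 (Pj j t).
  elim: j => [|j IH]; first exact: D1P.
  by apply: (g2_tile eK IH); rewrite Pj_dist.
have cPj j : continuous (Pj j).
  elim: j => [|j IH]; first exact: cP.
  by move=> t; apply: (@continuous_comp _ _ _ (Pj j) g2);
    [exact: IH|exact: continuous_g2].
pose u j t := al (k (Pj j t)).
have APj j t : 0 <= t <= 1 -> A (k (Pj j t)).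
  by move=> tI; apply: kA => //; rewrite Pj_dist; exact: r0P.
have cu j t : 0 <= t <= 1 -> {for t, continuous (u j)}.
  move=> tI; have ckP : continuous (k \o Pj j).
    exact: continuous_comp_within (cPj j) (dp_kcont dp) (D1Pj j).
  apply: (@continuous_comp _ _ _ (k \o Pj j) al); first exact: ckP.
  by have [] := alP _ (APj j t tI).
have uP j t : 0 <= t <= 1 -> has_angle (cx (Pj j t - o)) (cy (Pj j t - o)) (u j t).
  by move=> tI; have [_] := alP _ (APj j t tI); rewrite (dp_kK dp).
(* Cosine and sine of the doubled angle, by which [g2] rotates. *)
pose C := a ^+ 2 - b ^+ 2; pose S := 2 * a * b.
have CS : C ^+ 2 + S ^+ 2 = 1.
  by rewrite -(expr1n _ 2) -ab1 /C /S; ring.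
have [th [thC thS]] : exists th, cos th = C /\ sin th = S.
  have [|th [r r0' [eC eS]]] := @has_angle_ex _ C S.
    rewrite -negb_and; apply/negP => /andP[/eqP C0 /eqP S0].
    by move: CS; rewrite C0 S0 expr0n/= addr0 => /eqP; rewrite eq_sym oner_eq0.
  exists th; have : r ^+ 2 = 1 ^+ 2.
    rewrite expr1n -CS eC eS -[LHS]mulr1 -(cos2Dsin2 th); ring.
  move/eqP; rewrite eqrXn2 ?ltW// => /eqP r1.
  by rewrite eC eS r1 !mul1r.
have rotP j t : 0 <= t <= 1 -> cos (u j.+1 t - u j t) = C /\ sin (u j.+1 t - u
  j t) = S.
  move=> tI; have h := has_angle_rot th (uP j t tI).
  have [] := has_angle_uniq h (y := sin th * cx (Pj j t - o) + cos th * cy (Pj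
    j t - o))
    (b := u j.+1 t); last first.
    by rewrite -thC -thS; exact: cos_sin_B.
  have := uP j.+1 t tI; rewrite thC thS.
  have -> : Pj j.+1 t = o + lin a b 1 (lin a b 1 (Pj j t - o)).
    by rewrite -!gE addrC subrK.
  congr has_angle; rewrite !coordE /C /S; ring.
have step j : u j.+1 0 - u j 0 = u j.+1 1 - u j 1.
  apply: (@continuous_angle_const _ (fun t => u j.+1 t - u j t) _ _ C S);
    [exact: ler01|move=> t tI|exact: rotP].
  by apply: continuousB; exact: cu.
(* Consecutive paths are joined end to start, so the increment between them is the same [c] for all
   [j]. *)
have link j : u j 1 = u j.+1 0.
  by rewrite /u /Pj iterSr P0 P1.
pose c := u 1%N 0 - u 0%N 0.
have stepc j : u j.+1 0 - u j 0 = c.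
  by elim: j => // j <-; rewrite [RHS]step !link.
have lin_u j : u j 0 = u 0%N 0 + j%:R * c.
  elim: j => [|j IH]; first by rewrite mul0r addr0.
  by rewrite -(subrK (u j 0) (u j.+1 0)) stepc IH -natr1; ring.
(* Otherwise the doubled rotation angle has cosine 1, which forces [b = 0]. *)
have c0 : c != 0.
  have I0 : 0 <= (0 : R) <= 1 by rewrite lexx ler01.
  apply: contra_neq b0 => c0; have [] := rotP 0%N 0 I0.
  rewrite -/c c0 cos0 /C => C1 _; apply/eqP; rewrite -sqrf_eq0.
  have b2 : b ^+ 2 = 0 by move: ab1 C1; lra.
  by rewrite b2.
have [M [_ MA]] : bounded_set (al @` A).
  apply: compact_bounded; apply: continuous_compact => //.
  by apply: continuous_in_subspaceT => v /[!inE] /alP[].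
have uM j : `|u j 0| <= `|M| + 1.
  apply: (MA (`|M| + 1)); first by rewrite (le_lt_trans (ler_norm _))// ltrDl.
  by exists (k (Pj j 0)) => //; apply: APj; rewrite lexx ler01.
have c_gt0 : 0 < `|c| by rewrite normr_gt0.
pose N := (Num.truncn (2 * (`|M| + 1) / `|c|)).+1.
have : 2 * (`|M| + 1) / `|c| < N%:R by exact: truncnS_gt.
rewrite ltr_pdivrMr// ltNge => /negP; apply.
have -> : N%:R * `|c| = `|u N 0 - u 0%N 0|.
  by rewrite lin_u [_ + N%:R * c]addrC addrK normrM normr_nat.
rewrite (le_trans (ler_normB _ _))//.
by have := uM N; have := uM 0%N; lra.
Qed.

End Tiles.
End Rotations.

(** * Tilings of symmetric discs *)

Section ConvexDiscsAreDiscs.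
Variable R : realType.
Implicit Types (v w z : plane R) (K : set (plane R)).

(* [tau v] is the Euclidean distance from [z] to the boundary of [K] in the
   direction [v]. *)
Lemma radial_function K z : convex_disc K -> interior K z ->
  exists (tau : plane R -> R) (e M : R), [/\ 0 < e,
    forall v, v != 0 -> e <= tau v <= M,
    forall v, v != 0 -> {for v, continuous tau},
    forall (r : R) v, 0 < r -> v != 0 -> tau (r *: v) = tau v &
    forall v, v != 0 -> K (z + v) <-> enorm v <= tau v].
Proof.
move=> dK iz; have clK := disc_closed dK.
have /choice[b bP] : forall v, exists b : R, v != 0 -> 0 < b /\
    [/\ boundary K (z + b *: v),
      forall t : R, 0 <= t < b -> interior K (z + t *: v) &
      forall t : R, b < t -> ~ K (z + t *: v)].
  move=> v; have [v0|v0] := eqVneq v 0; first by exists 0.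
  by have [b b0 bP] := chord_end dK iz v0; exists b.
have bK v (t : R) : v != 0 -> 0 <= t -> K (z + t *: v) <-> t <= b v.
  move=> v0 t0; have [b0 [bb ib nb]] := bP v v0.
  split=> [Kt|]; first by rewrite leNgt; apply/negP => /nb.
  rewrite le_eqVlt => /predU1P[->|tb].
    by move: bb => [+ _]; rewrite -(closure_id _).1.
  by apply: interior_subset; apply: ib; rewrite t0.
pose tau v := enorm v * b v.
have tauK v (r : R) : v != 0 -> 0 <= r -> K (z + r *: v) <-> r * enorm v <= tau v.
  move=> v0 r0; rewrite bK// /tau mulrC ler_pM2l// enorm_gt0//.
have /interior_enormP[e e0 eK] := iz.
have [cK _ _] := dK; have [M [_ MK]] := compact_bounded cK.
have M1 : M < `|M| + 1 by rewrite (le_lt_trans (ler_norm _))// ltrDl.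
have {MK} MK v : K (z + v) -> enorm v <= 2 * (`|M| + 1 + `|z|).
  move=> /(MK _ M1) /= h; rewrite (le_trans (enorm_le _))// ler_pM2l//.
  have := ler_normB (z + v) z; rewrite addrC addKr => h2.
  by rewrite (le_trans h2)// lerD2r.
have tau_ge0 v : v != 0 -> 0 < tau v.
  by move=> v0; have [b0 _] := bP v v0; rewrite mulr_gt0// enorm_gt0.
have tauE v (r : R) : v != 0 -> 0 <= r -> r <= tau v <-> K (z + (r / enorm v) *: v).
  move=> v0 r0; have nv : 0 < enorm v by rewrite enorm_gt0.
  by rewrite tauK// ?divr_ge0 ?enorm_ge0// divfK// gt_eqF.
exists tau, (e / 2), (2 * (`|M| + 1 + `|z|)); split.
- by rewrite divr_gt0.
- move=> v v0; have nv : 0 < enorm v by rewrite enorm_gt0.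
  apply/andP; split.
    apply/tauE => //; first by rewrite divr_ge0// ltW.
    apply: eK; rewrite addrC addKr enormZ ger0_norm ?divr_ge0 ?enorm_ge0//;
      last first.
      by rewrite ltW.
    by rewrite divfK ?gt_eqF//; lra.
  have /(tauE v) := lexx (tau v).
  move=> /(_ v0 (ltW (tau_ge0 _ v0)))/MK.
  rewrite enormZ ger0_norm ?divr_ge0 ?enorm_ge0// ?divfK ?gt_eqF//.
  exact/ltW/tau_ge0.
- move=> v v0; rewrite /tau.
  apply: (@continuousM _ _ (fun v : plane R => enorm v) b).
    by apply: continuous_enorm; exact: cvg_id.
  have [b0 [_ ib nb]] := bP v v0.
  have cZ (t : R) : {for v, continuous (fun w : plane R => z + t *: w)}.
    by apply: continuousD; [exact: cst_continuous|exact: scaler_continuous].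
  have near0 : \forall w \near v, w != 0.
    apply/nbhs_enormP; exists (enorm v); first by rewrite enorm_gt0.
    move=> w; apply: contraTneq => ->.
    by rewrite sub0r enormN ltxx.
  (* At [t1], just below [b v], the ray is in the interior, and just above [b v] it is outside [K].
     Both conditions are open, so they squeeze [b w] for [w] near [v]. *)
  move=> A /nbhs_ballP[eps /= eps0 epsA].
  pose t1 := Num.max 0 (b v - eps / 2).
  have t10 : 0 <= t1 by rewrite le_max lexx.
  have t1b : t1 < b v by rewrite gt_max b0; lra.
  have t1e : b v - eps / 2 <= t1 by rewrite le_max lexx orbT.
  have nK1 : \forall w \near v, K (z + t1 *: w).
    by apply: (cZ t1 K (ib t1 _)); rewrite t10.
  have nK2 : \forall w \near v, ~ K (z + (b v + eps / 2) *: w).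
    have nbh : nbhs (z + (b v + eps / 2) *: v) (~` K).
      apply: open_nbhs_nbhs; split; first exact: closed_openC.
      by apply: nb; lra.
    exact: (cZ (b v + eps / 2) _ nbh).
  suff : \forall w \near v, A (b w) by [].
  apply: (filterS _ (filterI near0 (filterI nK1 nK2))) => w [w0 [k1 k2]].
  have h1 : t1 <= b w by apply/(bK _ _ w0 t10).
  have h2 : b w < b v + eps / 2.
    have h0 : 0 <= b v + eps / 2 by lra.
    rewrite ltNge; apply/negP => /(bK _ _ w0 h0).
    exact: k2.
  by apply: epsA; rewrite /ball/= ltr_norml; lra.
- move=> r v r0 v0; have nv : 0 < enorm v by rewrite enorm_gt0.
  have rv0 : r *: v != 0 by rewrite scaler_eq0 negb_or gt_eqF.
  have iff (s : R) : 0 <= s -> s <= tau (r *: v) <-> s <= tau v.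
    move=> s0; rewrite !tauE// enormZ gtr0_norm// scalerA.
    by rewrite (_ : s / (r * enorm v) * r = s / enorm v)//; field; rewrite !gt_eqF.
  apply/eqP; rewrite eq_le; apply/andP; split.
    by apply/iff; rewrite ?lexx// ltW// tau_ge0.
  by apply/iff; rewrite ?lexx// ltW// tau_ge0.
- by move=> v v0; have := tauK v 1 v0 ler01; rewrite scale1r mul1r.
Qed.

(** At the origin the bound on [s] takes the place of its continuity. *)
Lemma continuous_radial (s : plane R -> R) (B : R) :
  (forall v, v != 0 -> `|s v| <= B) ->
  (forall v, v != 0 -> {for v, continuous s}) ->
  continuous (fun v => s v *: v).
Proof.
move=> sB cs v; have [->|v0] := eqVneq v 0; last first.
  by apply: continuousZ; [exact: cs|exact: cvg_id].
have B1 : 0 < `|B| + 1 by rewrite ltr_wpDl.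
move=> A; rewrite /= scaler0 => /nbhs_enormP[e e0 eA].
apply/nbhs_enormP; exists (e / (`|B| + 1)); first by rewrite divr_gt0.
move=> w; rewrite subr0 ltr_pdivlMr// => we; apply: eA; rewrite subr0.
have [->|w0] := eqVneq w 0; first by rewrite scaler0 enorm0.
rewrite enormZ (le_lt_trans _ we)// mulrC ler_wpM2l ?enorm_ge0//.
by rewrite (le_trans (sB _ w0))// (le_trans (ler_norm _))// lerDl.
Qed.

(** Rays from an interior point are stretched by [tau]; as [tau] is constant along rays, division by
    [tau] is the inverse. *)
Lemma convex_disc_topological K : convex_disc K -> topological_disc K.
Proof.
move=> dK; have [_ _ [z iz]] := dK.
have [tau [e [M [e0 tauB ctau tauZ tauK]]]] := radial_function dK iz.
have tau0 v : v != 0 -> 0 < tau v.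
  by move=> /tauB/andP[+ _]; exact: lt_le_trans.
have Kz : K z by exact: interior_subset.
have dE x : unit_disc x <-> enorm x <= 1 by rewrite /unit_disc /= distE subr0.
pose f v := z + tau v *: v; pose k v := (tau (v - z))^-1 *: (v - z).
have fK : cancel f k.
  move=> v; rewrite /k /f [z + _]addrC addrK.
  have [->|v0] := eqVneq v 0; first by rewrite !scaler0.
  by rewrite tauZ ?tau0// scalerA mulVf ?scale1r// gt_eqF// tau0.
have kK : cancel k f.
  move=> v; rewrite /k /f; have [->|v0] := eqVneq v z.
    by rewrite subrr !scaler0 addr0.
  rewrite -subr_eq0 in v0; rewrite tauZ ?invr_gt0 ?tau0// scalerA mulfV.
    by rewrite scale1r addrC subrK.
  by rewrite gt_eqF// tau0.
have fKE x : enorm x <= 1 <-> K (f x).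
  rewrite /f; have [->|x0] := eqVneq x 0.
    by rewrite scaler0 addr0 enorm0; split.
  rewrite tauK; last by rewrite scaler_eq0 negb_or gt_eqF ?tau0.
  by rewrite tauZ ?tau0// enormZ gtr0_norm ?tau0// ger_pMr ?tau0.
exists f, k; split.
- apply: continuous_subspaceT => v.
  apply: (@continuousD _ _ _ (fun=> z) (fun v => tau v *: v));
    first exact: cst_continuous.
  apply: (@continuous_radial tau M) => // w w0.
  by rewrite gtr0_norm ?tau0//; have /andP[] := tauB w w0.
- apply: continuous_subspaceT => v.
  apply: (@continuous_comp _ _ _ (fun v => v - z) (fun w => (tau w)^-1 *: w)).
    by apply: continuousB; [exact: cvg_id|exact: cst_continuous].
  apply: (@continuous_radial (fun w => (tau w)^-1) e^-1) => w w0.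
    rewrite gtr0_norm ?invr_gt0 ?tau0// lef_pV2 ?posrE ?tau0//.
    by have /andP[] := tauB w w0.
  by apply: continuousV; [rewrite gt_eqF// tau0|exact: ctau].
- split=> _ [x xin <-]; first by apply/fKE/dE.
  by apply/dE/fKE; rewrite kK.
- by move=> x _; exact: fK.
- by move=> x _; exact: kK.
Qed.

End ConvexDiscsAreDiscs.

(** * Halving a convex disc by a line through an interior point *)

Section Halves.
Variable R : realType.
Implicit Types (x y z c n : plane R) (K : set (plane R)).

Definition half K c n := K `&` [set x | 0 <= dot (x - c) n].

Lemma convex_disc_half K c n : convex_disc K -> interior K c -> n != 0 ->
  convex_disc (half K c n).
Proof.
move=> dK ic n0; have [cK _ _] := dK; apply: convex_discP.
- apply: compact_closedI => //.
  apply: (@closed_comp _ _ (fun x => dot (x - c) n) [set t | 0 <= t]) => [x _|].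
    apply: (@continuous_dot R _ x (fun x => x - c) (fun=> n));
      last exact: cst_continuous.
    by apply: continuousB; [exact: cvg_id|exact: cst_continuous].
  exact: closed_ge.
- move=> x y t [Kx /= xn] [Ky /= yn] tI; split; first exact: disc_conv.
  have /andP[t0 t1] := tI.
  rewrite /= (_ : _ - c = (1 - t) *: (x - c) + t *: (y - c)).
    by rewrite dotDl !dotZl addr_ge0// mulr_ge0// subr_ge0.
  by apply: planeP; rewrite !coordE; ring.
- have /nbhs_interior/nbhs_enormP[e e0 eK] := ic.
  have nn0 : 0 < enorm n by rewrite enorm_gt0.
  pose s := e / (2 * enorm n).
  have s0 : 0 < s by rewrite divr_gt0// mulr_gt0.
  have se : s * enorm n = e / 2 by rewrite /s; field; rewrite gt_eqF.
  exists (c + s *: n); apply/interior_enormP; exists (e / 2);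
    first by rewrite divr_gt0.
  move=> q qe; have ne : enorm (s *: n) = e / 2 by rewrite enormZ gtr0_norm.
  have qc : q - c = (q - (c + s *: n)) + s *: n.
    by apply: planeP; rewrite !coordE; ring.
  split.
    apply: interior_subset; apply: eK; rewrite qc (le_lt_trans (ler_enormD _ _))//.
    by rewrite ne; lra.
  rewrite /= qc; set w := q - (c + s *: n) in qe *.
  have := cauchy_schwarz_norm w n; rewrite ler_norml => /andP[h _].
  rewrite dotDl dotZl -enorm_sqr expr2 mulrA se.
  have : enorm w * enorm n <= e / 2 * enorm n by rewrite ler_pM2r// ltW.
  by lra.
Qed.

(** The involution [g] preserves [K] and exchanges the sides of the line through [c] orthogonal to
    [n], so it exchanges the two halves. *)
Lemma tiling_by_halves K c n (g : plane R -> plane R) : convex_disc K ->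
  interior K c -> n != 0 -> euclidean_isometry g -> involutive g ->
  g @` K = K -> (forall x, dot (g x - c) n = - dot (x - c) n) ->
  exists T, monohedral_tiling K T /\ (T #= `I_2)%card.
Proof.
move=> dK ic n0 isog gg gK gn.
pose D1 := half K c n; pose D2 := half K c (- n).
have gKE x : K x -> K (g x) by rewrite -{2}gK; exists x.
have g12 : g @` D1 = D2.
  apply/seteqP; split=> [_ [x [Kx /= xn] <-]|x [Kx /= xn]].
    by split; [exact: gKE|rewrite /= dotNr gn opprK].
  exists (g x); last exact: gg.
  by split; [exact: gKE|rewrite /= gn -dotNr].
have g21 : g @` D2 = D1.
  rewrite -g12; apply/seteqP; split=> [_ [_ [x Dx <-] <-]|x Dx]; first by rewrite gg.
  by exists (g x); [exists x|exact: gg].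
have dD1 : convex_disc D1 by exact: convex_disc_half.
have dD2 : convex_disc D2 by apply: convex_disc_half; rewrite // oppr_eq0.
have disj x : interior D1 x -> ~ interior D2 x.
  move=> i1 /interior_enormP[e e0 eD].
  have [_ /= xn1] := interior_subset i1.
  have nn0 : 0 < enorm n by rewrite enorm_gt0.
  pose s := e / (2 * enorm n).
  have s0 : 0 < s by rewrite divr_gt0// mulr_gt0.
  have se : s * enorm n = e / 2 by rewrite /s; field; rewrite gt_eqF.
  have [] := eD (x + s *: n).
    by rewrite addrC addKr enormZ gtr0_norm// se; lra.
  move=> _; rewrite /= dotNr addrAC dotDl dotZl oppr_ge0 leNgt => /negP; apply.
  by rewrite ltr_wpDl// mulr_gt0// dot_gt0.
have D12 : D1 <> D2.
  move=> e; have [_ _ [x i1]] := dD1; apply: (disj x i1).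
  by rewrite -e.
exists [set D1; D2]; split.
  split; first split.
  - exact: finite_set2.
  - by move=> D [->|->]; exact: convex_disc_topological.
  - rewrite bigcup_setU !bigcup_set1 -setIUr.
    rewrite [X in K `&` X](_ : _ = setT) ?setIT//.
    apply/seteqP; split=> x //= _; rewrite dotNr oppr_ge0.
    by have [] := leP 0 (dot (x - c) n) => h; [left|right; rewrite ltW].
  - move=> D E [->|->] [->|->] // [x [i1 i2]]; exfalso.
      exact: (disj x).
    exact: (disj x).
  - have cid (D : set (plane R)) : congruent D D by exists id => //; rewrite image_id.
    by move=> D E [->|->] [->|->] //; exists g.
apply/eq_cardSP; exists D1; first by left.
have -> : [set D1; D2] `\ D1 = [set D2].
  apply/seteqP; split=> [D [[->|->] nD]|D ->]; [by case: nD|by []|].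
  by split=> [|/= /esym]; [right|exact: D12].
exact: card_set1.
Qed.

End Halves.

(** * Involutive isometries *)

Section Symmetries.
Variable R : realType.
Implicit Types (x y z a c u : plane R) (K D : set (plane R)).

(** For [s = 1] the involution forces [b = 0] and [a = -1], a half-turn about half of [c]. For
    [s = -1] the axis passes through half of [c] in a direction fixed by the linear part. *)
Lemma involutive_isometry (g : plane R -> plane R) : euclidean_isometry g ->
  involutive g -> g != id ->
  (exists c, g = point_reflection c) \/
  (exists a u, u != 0 /\ g = line_reflection a u).
Proof.
move=> isog gg gid; have [a [b [s [ab s2 gE]]]] := isometry_lin isog.
set c := g 0 in gE; have Sc : lin a b s c = - c.
  by have := gg 0; rewrite -/c gE => /eqP; rewrite addr_eq0 => /eqP.
have cxSc := congr1 cx Sc; have cySc := congr1 cy Sc; rewrite !coordE in cxSc cySc.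
have gcoord x : g x = vec (a * cx x - s * b * cy x + cx c) (b * cx x + s * a *
  cy x + cy c).
  by rewrite gE; apply: planeP; rewrite !coordE.
have : (s - 1) * (s + 1) = 0 by transitivity (s ^+ 2 - 1); [ring|rewrite s2 subrr].
move/eqP; rewrite mulf_eq0 subr_eq0 addr_eq0 => /orP[/eqP s1|/eqP s1]; subst s.
- have b0 : b = 0.
    have := congr1 cx (gg (vec 0 1)); rewrite !gcoord !coordE => h1.
    have := congr1 cx (gg 0); rewrite !gcoord !coordE => h2.
    have := congr1 cx (gg (vec 1 0)); rewrite !gcoord !coordE => h3.
    have e1 : a * b = 0 by lra.
    have e2 : a ^+ 2 - b ^+ 2 = 1 by rewrite !expr2; lra.
    have b2 : b ^+ 2 = 0 by lra.
    by apply/eqP; rewrite -sqrf_eq0 b2.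
  subst b; have : (a - 1) * (a + 1) = 0.
    by transitivity (a ^+ 2 + 0 ^+ 2 - 1); [ring|rewrite ab subrr].
  move/eqP; rewrite mulf_eq0 subr_eq0 addr_eq0 => /orP[/eqP a1|/eqP a1]; subst a.
    case/eqP: gid; apply/funext => x; rewrite gcoord.
    by apply: planeP; rewrite !coordE; lra.
  left; exists (2^-1 *: c); apply/funext => x; rewrite gcoord.
  by apply: planeP; rewrite !coordE !mulr2n; field.
(* The fixed direction [vec (1 + a) b] degenerates for [a = -1], where the axis is vertical. *)
- right; have [a1|a1] := eqVneq a (-1).
    subst a; have b0 : b = 0.
      have b2 : b ^+ 2 = 0 by move: ab; rewrite sqrrN expr1n; lra.
      by apply/eqP; rewrite -sqrf_eq0 b2.
    subst b; exists (2^-1 *: c), (vec 0 1); split.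
      by rewrite -dot_eq0 dotE !coordE mulr0 add0r mulr1 oner_eq0.
    apply/funext => x; rewrite gcoord /line_reflection.
    have -> : dot (vec 0 1) (vec 0 1) = 1 :> R by rewrite dotE !coordE; ring.
    have cy0 : cy c = 0 by lra.
    by apply: planeP; rewrite divr1 !dotE !coordE cy0 !mulr2n; field.
  have a10 : 1 + a != 0 by rewrite addrC addr_eq0.
  have uu : dot (vec (1 + a) b) (vec (1 + a) b) = 2 * (1 + a).
    rewrite dotE !coordE; transitivity (1 + 2 * a + (a ^+ 2 + b ^+ 2)); first by ring.
    by rewrite ab; ring.
  exists (2^-1 *: c), (vec (1 + a) b); split.
    by rewrite -dot_eq0 uu mulf_neq0.
  apply/funext => x; rewrite gcoord /line_reflection uu.
  have cE : (1 + a) * cx c + b * cy c = 0 by lra.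
  have -> : dot (x - 2^-1 *: c) (vec (1 + a) b) = (1 + a) * cx x + b * cy x.
    rewrite dotE !coordE; transitivity
      ((1 + a) * cx x + b * cy x - 2^-1 * ((1 + a) * cx c + b * cy c)); first by ring.
    by rewrite cE mulr0 subr0.
  have b2 : b ^+ 2 = (1 - a) * (1 + a) by rewrite -[LHS](addKr (a ^+ 2)) ab; ring.
  apply: planeP; rewrite !coordE !mulr2n; first by field.
  transitivity (cy c + b * cx x + b ^+ 2 / (1 + a) * cy x - cy x); last by field.
  by rewrite b2 mulfK//; ring.
Qed.

Lemma point_reflection_isometry c : euclidean_isometry (point_reflection c :
  plane R -> plane R).
Proof.
move=> x y; rewrite !distE -enormN; congr enorm.
by apply: planeP; rewrite !coordE; ring.
Qed.

Lemma point_reflectionK c : involutive (point_reflection c : plane R -> plane R).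
Proof. by move=> x; rewrite /point_reflection opprB addrC subrK. Qed.

Lemma line_reflection_isometry a u : u != 0 ->
  euclidean_isometry (line_reflection a u).
Proof.
move=> u0 x y; rewrite !distE; congr Num.sqrt.
have uu : dot u u != 0 by rewrite dot_eq0.
have -> : line_reflection a u x - line_reflection a u y =
    (2 * (dot (x - y) u / dot u u)) *: u - (x - y).
  apply: planeP; rewrite !coordE !dotE !coordE !mulr2n;
    by rewrite dotE in uu; field.
move: (x - y) => w; rewrite !dotE_lin (dotC u w).
by field.
Qed.

Lemma dot_line_reflection a u x : u != 0 ->
  dot (line_reflection a u x - a) u = dot (x - a) u.
Proof.
move=> u0; have uu : dot u u != 0 by rewrite dot_eq0.
rewrite /line_reflection; set k := _ / _.
have -> : (a + k *: u) *+ 2 - x - a = (2 * k) *: u - (x - a).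
  by apply: planeP; rewrite !coordE !mulr2n; ring.
rewrite /k; move: (x - a) => w; rewrite dotDl dotNl dotZl. by field.
Qed.

Lemma line_reflectionK a u : u != 0 -> involutive (line_reflection a u).
Proof.
move=> u0 x; rewrite {1}/line_reflection dot_line_reflection// /line_reflection.
by rewrite opprB addrC subrK.
Qed.

End Symmetries.

(** * Tilings of a smooth, strictly convex disc *)

Section Tilings.
Variable R : realType.
Variable K : set (plane R).
Hypotheses (dK : convex_disc K) (stK : strictly_convex K) (smK : smooth K).

(** For a point reflection this midpoint is the centre, for a line reflection it lies on the axis:
    it is the interior point through which [K] is halved. *)
Lemma midpoint_interior (g : plane R -> plane R) : euclidean_isometry g ->
  g @` K = K -> exists2 z, interior K z & interior K ((1 - 2^-1) *: z + 2^-1 *: g z).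
Proof.
move=> isog gK; have [_ _ [z iz]] := dK; exists z => //.
apply: interior_conv => //; first exact: interior_subset.
  by apply: isometry_interior iz => //; rewrite gK.
by lra.
Qed.

Lemma symmetric_tiling : centrally_symmetric K \/ axially_symmetric K ->
  exists T, monohedral_tiling K T /\ (T #= `I_2)%card.
Proof.
move=> [[c cK]|[a [u [u0 aK]]]].
- have isog := point_reflection_isometry c.
  have [z _ ic] := midpoint_interior isog cK.
  have cE : (1 - 2^-1) *: z + 2^-1 *: point_reflection c z = c.
    by apply: planeP; rewrite !coordE !mulr2n; field.
  rewrite cE in ic; have n0 : vec 1 0 != 0 :> plane R.
    by rewrite -dot_eq0 dotE !coordE mulr0 addr0 mulr1 oner_eq0.
  apply: (tiling_by_halves dK ic n0 isog (point_reflectionK c) cK) => x.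
  by rewrite !dotE !coordE !mulr2n; ring.
- have isog := line_reflection_isometry a u0.
  have [z _ ic] := midpoint_interior isog aK.
  have uu : dot u u != 0 by rewrite dot_eq0.
  have n0 : vec (- cy u) (cx u) != 0 :> plane R.
    by rewrite -dot_eq0 dotE !coordE mulrNN addrC -dotE.
  apply: (tiling_by_halves dK ic n0 isog (line_reflectionK a u0) aK) => x.
  rewrite /line_reflection; move: (_ / _) (_ / _) => k l.
  by rewrite !dotE !coordE !mulr2n; field.
Qed.

(** The linear part is an involution when [s = -1], and when [s = 1] and [b = 0]; then [no_glide]
    says that [g \o g] is the identity. The remaining isometries are rotations, whose centre would
    have to be interior to [K] and cannot be. *)
Lemma tiling_isometry_involutive (D1 D2 : set (plane R)) (g : plane R -> plane R) :
  D1 <> D2 -> monohedral_tiling K [set D1; D2] -> euclidean_isometry g ->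
  g @` D1 = D2 -> involutive g.
Proof.
move=> D12 [[_ disc cover triv] _] isog gD.
have [f1 [k1 dp1]] := topological_disc_param (disc D1 (or_introl erefl)).
have [f2 [k2 dp2]] := topological_disc_param (disc D2 (or_intror erefl)).
have tt : two_tiles K D1 D2 f1 k1 f2 k2 g.
  split=> //; first by rewrite -cover bigcup_setU !bigcup_set1.
  move=> x i1 i2; apply: D12; apply: triv; [by left|by right|].
  by exists x.
have [a [b [s [ab s2 gE]]]] := isometry_lin isog.
have : (s - 1) * (s + 1) = 0 by transitivity (s ^+ 2 - 1); [ring|rewrite s2 subrr].
have glide : (forall x, lin a b s (lin a b s x) = x) -> involutive g.
  move=> SK x.
  have normS y : enorm (lin a b s y) = enorm y by rewrite /enorm dot_lin.
  have c0 := no_glide dK stK smK tt (S := lin a b s) (c := g 0)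
    (@lin_linear _ a b s) normS SK gE.
  rewrite (gE (g x)) (gE x) -(scale1r (lin a b s x)) lin_linear scale1r SK.
  by rewrite -addrA c0 addr0.
move/eqP; rewrite mulf_eq0 subr_eq0 addr_eq0 => /orP[/eqP s1|/eqP s1]; subst s.
  have [b0|b0] := eqVneq b 0.
    apply: glide => x; move: ab; rewrite b0 expr0n addr0 => a2.
    apply: planeP; rewrite !coordE.
      by transitivity (a ^+ 2 * cx x); [ring|rewrite a2 mul1r].
    by transitivity (a ^+ 2 * cy x); [ring|rewrite a2 mul1r].
  have [w0 oE] := rotation_fixed_point a (g 0) b0.
  have gE' w : g (w0 + w) = w0 + lin a b 1 w.
    by rewrite gE -(scale1r w0) lin_linear !scale1r addrAC oE.
  exfalso; apply: (no_inner_rotation tt ab b0 gE').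
  exact: (rotation_center_interior dK stK smK tt ab b0 gE').
apply: glide => x; apply: planeP; rewrite !coordE.
  by transitivity ((a ^+ 2 + b ^+ 2) * cx x); [ring|rewrite ab mul1r].
by transitivity ((a ^+ 2 + b ^+ 2) * cy x); [ring|rewrite ab mul1r].
Qed.

Lemma tiling_isometry_symmetry (D1 D2 : set (plane R)) (g : plane R -> plane R) :
  D1 <> D2 -> monohedral_tiling K [set D1; D2] -> euclidean_isometry g ->
  g @` D1 = D2 ->
  (exists c, symmetry_center K c /\ g = point_reflection c) \/
  (exists a u, symmetry_axis K a u /\ g = line_reflection a u).
Proof.
move=> D12 til isog gD; have gg := tiling_isometry_involutive D12 til isog gD.
have gK : g @` K = K.
  have [[_ _ <- _] _] := til; rewrite bigcup_setU !bigcup_set1 image_setU gD.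
  rewrite setUC; congr (_ `|` _); rewrite -gD; apply/seteqP;
    split=> [_ [_ [x Dx <-] <-]|x Dx].
    by rewrite gg.
  by exists (g x); [exists x|exact: gg].
(* The tiles are distinct, which excludes the trivial involution. *)
have gid : g != id by apply: contra_notN D12 => /eqP g1; rewrite -gD g1 image_id.
have [[c gE]|[a [u [u0 gE]]]] := involutive_isometry isog gg gid.
  by left; exists c; split=> //; rewrite /symmetry_center -gE.
by right; exists a, u; split=> //; split=> //; rewrite -gE.
Qed.

End Tilings.

Theorem theorem1p1 (R : realType) (K : set (plane R))
    (convexK : convex_disc K) (strictK : strictly_convex K)
    (smoothK : smooth K) :
  ((exists T : set (set (plane R)),
       monohedral_tiling K T /\ (T #= `I_2)%card)
     <-> centrally_symmetric K \/ axially_symmetric K)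
  /\
  (forall D1 D2 : set (plane R), D1 <> D2 ->
     monohedral_tiling K [set D1; D2] ->
     forall g : plane R -> plane R, euclidean_isometry g -> g @` D1 = D2 ->
       (exists c : plane R, symmetry_center K c /\ g = point_reflection c)
       \/ (exists a u : plane R,
             symmetry_axis K a u /\ g = line_reflection a u)).
Proof.
split; last by move=> D1 D2 D12 til g; exact: tiling_isometry_symmetry.
split=> [[T [til /eq_cardSP[D1 TD1 /eq_cardSP[D2 [TD2 D21]]]]]|]; last first.
  exact: symmetric_tiling.
rewrite II0 card_eq0 => /eqP T0.
have TE : T = [set D1; D2].
  apply/seteqP; split=> [D TD|D [->|->]//].
  have [->|nD1] := pselect (D = D1); first by left.
  have [->|nD2] := pselect (D = D2); first by right.
  by have : set0 D by rewrite -T0.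
subst T; have D12 : D1 <> D2 by move/esym.
have [g isog gD] := til.2 D1 D2 TD1 TD2.
have [[c [cK _]]|[a [u [aK _]]]] :=
    tiling_isometry_symmetry convexK strictK smoothK D12 til isog gD.
  by left; exists c.
by right; exists a, u.
Qed.
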